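(* Let $d\in\mathbb{N}$. Assume that $n,N\in\mathbb{N}$ with $n\le(3/4)N$ and $\boldsymbol{p}\in N^{-1}\,\mathbb{N}_0^d\cap\mathrm{Int}(\mathcal{S}_d)$. Let $\boldsymbol{K}\sim\mathrm{Hypergeometric}(N,n,\boldsymbol{p})$, $\boldsymbol{L}\sim\mathrm{Multinomial}(n,\boldsymbol{p})$, and $\boldsymbol{U},\boldsymbol{V}\sim\mathrm{Uniform}(-1/2,1/2)^d$, where $\boldsymbol{K},\boldsymbol{L},\boldsymbol{U},\boldsymbol{V}$ are jointly independent. Define $\boldsymbol{X}=\boldsymbol{K}+\boldsymbol{U}$ and $\boldsymbol{Y}=\boldsymbol{L}+\boldsymbol{V}$, and let $\widetilde{\mathbb{P}}_{N,n,\boldsymbol{p}}$ and $\widetilde{\mathbb{Q}}_{n,\boldsymbol{p}}$ be the laws of $\boldsymbol{X}$ and $\boldsymbol{Y}$, respectively. Let $\mathbb{Q}_{n,\boldsymbol{p}}$ be the law of the $\mathrm{Normal}_d(n\boldsymbol{p},n\Sigma_{\boldsymbol{p}})$ distribution, where $\Sigma_{\boldsymbol{p}}=\mathrm{diag}(\boldsymbol{p})-\boldsymbol{p}\boldsymbol{p}^\top$. Then, as $N\to\infty$, $$\begin{aligned}\|\widetilde{\mathbb{P}}_{N,n,\boldsymbol{p}}-\mathbb{Q}_{n,\boldsymbol{p}}\|&\le\sqrt{2\sum_{i=1}^{d+1}\left(\frac1{\nu_i}\right)^{n\nu_ip_i}\left(\frac{1-p_i}{1-\nu_ip_i}\right)^{n(1-\nu_ip_i)}+\mathcal{O}\left(\frac{n^2}{N}\right)}\\&\quad+\mathcal{O}\left(\frac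 d{\sqrt n}\sqrt{\frac{\max\{p_1,\dots,p_d,p_{d+1}\}}{\min\{p_1,\dots,p_d,p_{d+1}\}}}\right),\end{aligned}$$ where $\nu_i=\lceil p_i^{-1}-1\rceil$ for $1\le i\le d+1$, and $\|\cdot\|$ denotes the total variation norm.
   Context: $\mathbb{N}=\{1,2,\dots\}$, $\mathbb{N}_0=\mathbb{N}\cup\{0\}$, and $\|\boldsymbol{x}\|_1=\sum_{i=1}^d|x_i|$ on $\mathbb{R}^d$. The simplex and its interior are $\mathcal{S}_d=\{\boldsymbol{x}\in[0,1]^d:\|\boldsymbol{x}\|_1\le1\}$ and $\mathrm{Int}(\mathcal{S}_d)=\{\boldsymbol{x}\in(0,1)^d:\|\boldsymbol{x}\|_1<1\}$. For $\boldsymbol{p}\in N^{-1}\mathbb{N}_0^d\cap\mathrm{Int}(\mathcal{S}_d)$ put $p_{d+1}=1-\|\boldsymbol{p}\|_1>0$, and for $\boldsymbol{k}\in\mathbb{N}_0^d\cap n\mathcal{S}_d$ put $k_{d+1}=n-\|\boldsymbol{k}\|_1$. $\mathrm{Hypergeometric}(N,n,\boldsymbol{p})$ is the distribution with probability mass function $$P_{N,n,\boldsymbol{p}}(\boldsymbol{k})=\frac{\prod_{i=1}^{d+1}\binom{Np_i}{k_i}}{\binom Nn},\qquad \boldsymbol{k}\in\mathbb{K}_d=\{\boldsymbol{k}\in\mathbb{N}_0^d\cap n\mathcal{S}_d: k_i\in[0,Np_i]\text{ for all }1\le i\le d+1\},$$ and $\mathrm{Multinomial}(n,\boldsymbol{p})$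 is the distribution with probability mass function $$Q_{n,\boldsymbol{p}}(\boldsymbol{k})=\frac{n!}{\prod_{i=1}^{d+1}k_i!}\prod_{i=1}^{d+1}p_i^{k_i},\qquad \boldsymbol{k}\in\mathbb{N}_0^d\cap n\mathcal{S}_d.$$ $\mathrm{Normal}_d(\boldsymbol{\mu},\Sigma)$ is the $d$-dimensional normal distribution with mean $\boldsymbol{\mu}$ and covariance matrix $\Sigma$; $\mathrm{Uniform}(-1/2,1/2)^d$ is the uniform distribution on the cube $(-1/2,1/2)^d$. Convention: $u=\mathcal{O}(v)$ means $\limsup_{N\to\infty}|u/v|<C$ where $C\in(0,\infty)$ is a universal constant. *)

(* Defs.v *)
(* Vectors of R^d are d.-tuple R, with the product
   sigma-algebra that the library puts on tuples. *)
From HB Require Import structures.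
From mathcomp Require Import all_boot all_order all_algebra.
From mathcomp Require Import all_classical all_reals all_analysis.

Set Implicit Arguments.
Unset Strict Implicit.
Unset Printing Implicit Defensive.

Import Order.TTheory GRing.Theory Num.Theory.
Import numFieldNormedType.Exports.

Local Open Scope classical_set_scope.
Local Open Scope ring_scope.

Definition norm1 (R : realType) (d : nat) (x : d.-tuple R) : R :=
  \sum_(i < d) `|tnth x i|.

Definition tuple_add (R : realType) (d : nat) (x y : d.-tuple R) : d.-tuple R :=
  [tuple tnth x i + tnth y i | i < d].

Definition row_of (R : realType) (d : nat) (x : d.-tuple R) : 'rV[R]_d :=
  \row_(i < d) tnth x i.

Definition nat_vec (R : realType) (d : nat) (k : d.-tuple nat) : d.-tuple R :=
  [tuple (tnth k i)%:R | i < d].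

(* (p_1, ..., p_{d+1}) and (k_1, ..., k_{d+1}). *)
Definition pbar (R : realType) (d : nat) (p : d.-tuple R) : d.+1.-tuple R :=
  [tuple of rcons p (1 - norm1 p)].

(* The subtraction is truncated, so this is only meaningful when the sum of
   the k_i is at most n. *)
Definition kbar (d : nat) (n : nat) (k : d.-tuple nat) : d.+1.-tuple nat :=
  [tuple of rcons k (n - \sum_(i < d) tnth k i)%N].

Definition int_simplex (R : realType) (d : nat) : set (d.-tuple R) :=
  [set x | (forall i : 'I_d, 0 < tnth x i < 1) /\ norm1 x < 1].

Definition lattice (R : realType) (d : nat) (N : nat) : set (d.-tuple R) :=
  [set x | forall i : 'I_d, N%:R * tnth x i \is a Num.nat].

Definition admissible (R : realType) (d : nat) (N n : nat) (p : d.-tuple R) :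
    Prop :=
  [/\ (0 < N)%N, (0 < n)%N, n%:R <= 3 / 4 * N%:R :> R,
      lattice N p & int_simplex p].

Definition lebesgue_cons (R : realType) (d : nat)
    (m : {sigma_finite_measure set (d.-tuple R) -> \bar R}) :
    set (d.+1.-tuple R) -> \bar R :=
  pushforward (lebesgue_measure \x m)%E
    (fun z : R * d.-tuple R => [tuple of z.1 :: z.2]).

Section lebesgue_cons.
Context (R : realType) (d : nat)
  (m : {sigma_finite_measure set (d.-tuple R) -> \bar R}).

Lemma measurable_cons_pair : measurable_fun [set: R * d.-tuple R]
  (fun z => [tuple of z.1 :: z.2] : d.+1.-tuple R).
Proof. exact: measurable_cons. Qed.

Let mu0 : lebesgue_cons m set0 = 0%E.
Proof. by rewrite /lebesgue_cons /pushforward preimage_set0; exact: (measure0 (lebesgue_measure \x m)%E). Qed.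

Let mu_ge0 A : (0 <= lebesgue_cons m A)%E.
Proof. exact: (measure_ge0 (lebesgue_measure \x m)%E). Qed.

Let mu_sigma_additive : semi_sigma_additive (lebesgue_cons m).
Proof.
move=> F mF tF mUF; rewrite /lebesgue_cons /pushforward preimage_bigcup.
have mpre A : measurable A -> measurable
    ((fun z : R * d.-tuple R => [tuple of z.1 :: z.2]) @^-1` A).
  by move=> mA; rewrite -[X in measurable X]setTI; exact: measurable_cons_pair.
apply: (@measure_semi_sigma_additive _ _ _ (lebesgue_measure \x m)%E).
- by move=> n; exact: mpre.
- apply/trivIsetP => /= i j _ _ ij; rewrite -preimage_setI.
  by move/trivIsetP : tF => /(_ _ _ _ _ ij) ->//; rewrite preimage_set0.
- by rewrite -preimage_bigcup; exact: mpre.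
Qed.

HB.instance Definition _ := isMeasure.Build _ _ _ (lebesgue_cons m)
  mu0 mu_ge0 mu_sigma_additive.

Let measurable_thead : measurable_fun [set: d.+1.-tuple R] (@thead d R).
Proof. exact: measurable_tnth. Qed.

Let mu_sigma_finite : sigma_finite setT (lebesgue_cons m).
Proof.
have /sigma_finiteP[F [TF ndF Foo]] :=
  sigma_finiteT (@lebesgue_measure R : {sigma_finite_measure set _ -> \bar R}).
have /sigma_finiteP[G [TG ndG Goo]] := sigma_finiteT m.
pose g (t : d.+1.-tuple R) : R * d.-tuple R := (thead t, [tuple of behead t]).
have mg : measurable_fun setT g.
  by apply/measurable_fun_pair; [exact: measurable_thead|
                                 exact: measurable_behead].
exists (fun k => g @^-1` (F k `*` G k)).
  rewrite -preimage_bigcup (_ : \bigcup_k _ = setT) ?preimage_setT//.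
  apply/seteqP; split => // -[x y] _.
  have [i _ Fi] : (\bigcup_k F k) x by rewrite -TF.
  have [j _ Gj] : (\bigcup_k G k) y by rewrite -TG.
  exists (maxn i j) => //; split => /=.
    by move: x Fi; exact/subsetPset/ndF/leq_maxl.
  by move: y Gj; exact/subsetPset/ndG/leq_maxr.
move=> k; have [mF Fk] := Foo k; have [mG Gk] := Goo k; split.
  by rewrite -[X in measurable X]setTI; apply: mg => //; exact: measurableX.
rewrite /lebesgue_cons /pushforward -comp_preimage.
rewrite (_ : g \o _ = id).
  rewrite preimage_id product_measure1E//.
  by rewrite lte_mul_pinfty// ge0_fin_numE.
by apply/funext => -[x y]; rewrite /g /=; congr pair; apply/val_inj.
Qed.

HB.instance Definition _ := Measure_isSigmaFinite.Build _ _ _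
  (lebesgue_cons m) mu_sigma_finite.

End lebesgue_cons.

(* Lebesgue measure on R^d, as an iterated product. *)
Fixpoint lebesgue_tuple (R : realType) (d : nat) :
    {sigma_finite_measure set (d.-tuple R) -> \bar R} :=
  match d return {sigma_finite_measure set (d.-tuple R) -> \bar R} with
  | 0 => \d_([tuple] : 0.-tuple R)
  | d'.+1 => lebesgue_cons (lebesgue_tuple R d')
  end.

Lemma lebesgue_tuple_box (R : realType) (d : nat) (A : 'I_d -> set R) :
  (forall i, measurable (A i)) ->
  lebesgue_tuple R d [set x | forall i, A i (tnth x i)] =
  (\prod_(i < d) lebesgue_measure (A i))%E.
Proof.
elim: d A => [|d IHd] A mA.
  by rewrite big_ord0 /= diracE mem_set// => -[].
rewrite big_ord_recl /= /lebesgue_cons /pushforward.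
rewrite -(IHd (fun i => A (lift ord0 i)))//.
have mB : measurable [set x : d.-tuple R | forall i : 'I_d, A (lift ord0 i) (tnth x i)].
  rewrite (_ : mkset _ = \big[setI/setT]_(i < d)
      ((fun x : d.-tuple R => tnth x i) @^-1` A (lift ord0 i))).
    apply: bigsetI_measurable => i _; rewrite -[X in measurable X]setTI.
    exact: measurable_tnth.
  apply/seteqP; split => [x /= xA|x].
    by rewrite -bigcap_seq => i _ /=; exact: xA.
  by rewrite -bigcap_seq => + i => /(_ i); apply; rewrite /= mem_index_enum.
have := product_measure1E (@lebesgue_measure R) (lebesgue_tuple R d)
  (mA ord0) mB.
move=> <-.
congr ((_ \x _)%E _); apply/seteqP; split => -[x y] /=.
  move=> xyA; split; first exact: (xyA ord0).
  by move=> i; have := xyA (lift ord0 i); rewrite tnthS.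
by move=> [xA yA] i; case: (unliftP ord0 i) => [j|] ->; rewrite ?tnthS.
Qed.

Definition cube (R : realType) (d : nat) : set (d.-tuple R) :=
  [set x | forall i : 'I_d, - (1 / 2) < tnth x i < 1 / 2].

(* The cube has Lebesgue measure 1, so no normalization is needed. *)
Definition uniform_law (R : realType) (d : nat) (A : set (d.-tuple R)) : \bar R :=
  lebesgue_tuple R d (A `&` @cube R d).

Definition hypergeometric_support (R : realType) (d : nat) (N n : nat)
    (p : d.-tuple R) : set (d.-tuple nat) :=
  [set k | (\sum_(i < d) tnth k i <= n)%N /\
    forall i : 'I_d.+1, (tnth (kbar n k) i)%:R <= N%:R * tnth (pbar p) i].

(* For p in the lattice, each N p_i is a natural number and Num.truncn only
   converts its type. *)
Definition hypergeometric_pmf (R : realType) (d : nat) (N n : nat)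
    (p : d.-tuple R) (k : d.-tuple nat) : R :=
  (\prod_(i < d.+1)
     'C(Num.truncn (N%:R * tnth (pbar p) i), tnth (kbar n k) i)%:R)
  / 'C(N, n)%:R.

Definition multinomial_support (d : nat) (n : nat) : set (d.-tuple nat) :=
  [set k | (\sum_(i < d) tnth k i <= n)%N].

Definition multinomial_pmf (R : realType) (d : nat) (n : nat)
    (p : d.-tuple R) (k : d.-tuple nat) : R :=
  n`!%:R / (\prod_(i < d.+1) (tnth (kbar n k) i)`!%:R)
  * \prod_(i < d.+1) tnth (pbar p) i ^+ tnth (kbar n k) i.

Definition discrete_law (R : realType) (d : nat) (S : set (d.-tuple nat))
    (f : d.-tuple nat -> R) (A : set (d.-tuple R)) : \bar R :=
  \esum_(k in S `&` (@nat_vec R d @^-1` A)) (f k)%:E.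

Definition hypergeometric_law (R : realType) (d : nat) (N n : nat)
    (p : d.-tuple R) : set (d.-tuple R) -> \bar R :=
  discrete_law (hypergeometric_support N n p) (hypergeometric_pmf N n p).

Definition multinomial_law (R : realType) (d : nat) (n : nat)
    (p : d.-tuple R) : set (d.-tuple R) -> \bar R :=
  discrete_law (@multinomial_support d n) (multinomial_pmf n p).

Definition mvnormal_pdf (R : realType) (d : nat) (mu : 'rV[R]_d)
    (Sigma : 'M[R]_d) (x : d.-tuple R) : R :=
  (Num.sqrt ((2 * pi) ^+ d * \det Sigma))^-1 *
  expR (- (((row_of x - mu) *m invmx Sigma *m (row_of x - mu)^T) 0 0) / 2).

(* Sigma is meant to be symmetric positive definite. *)
Definition mvnormal_law (R : realType) (d : nat) (mu : 'rV[R]_d)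
    (Sigma : 'M[R]_d) (A : set (d.-tuple R)) : \bar R :=
  (\int[lebesgue_tuple R d]_(x in A) (mvnormal_pdf mu Sigma x)%:E)%E.

Definition multinomial_cov (R : realType) (d : nat) (p : d.-tuple R) : 'M[R]_d :=
  diag_mx (row_of p) - (row_of p)^T *m row_of p.

Definition has_law (R : realType) (disp disp' : measure_display)
    (Omega : measurableType disp) (T : measurableType disp')
    (P : probability Omega R) (X : {RV P >-> T}) (mu : set T -> \bar R) : Prop :=
  forall A : set T, measurable A -> distribution P X A = mu A.
Arguments has_law {R disp disp' Omega T} P X mu.

(* The product rule for subfamilies follows by taking A i = setT. *)
Definition mutually_independent (R : realType) (disp disp' : measure_display)
    (Omega : measurableType disp) (T : measurableType disp')
    (P : probability Omega R) (m : nat) (X : m.-tuple {RV P >-> T}) : Prop :=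
  forall A : 'I_m -> set T, (forall i, measurable (A i)) ->
    P [set w | forall i, A i (tnth X i w)] =
    (\prod_(i < m) P (tnth X i @^-1` A i))%E.
Arguments mutually_independent {R disp disp' Omega T} P {m} X.

(* The total variation norm |mu - nu|(T) of the signed measure mu - nu, that
   is twice the supremum of |mu A - nu A| when mu and nu are probability
   measures. *)
Definition tv_norm (R : realType) (disp : measure_display)
    (T : measurableType disp) (mu nu : set T -> \bar R) : \bar R :=
  ereal_sup [set (\sum_(0 <= k <oo) `|mu (F k) - nu (F k)|)%E | F in
    [set F : nat -> set T | [/\ forall k, measurable (F k),
                               trivIset setT F & \bigcup_k F k = setT]]].

(* u = O(v) as N -> oo with constant C, for quantities depending on N and on
   n and p, which may vary with N. *)
Definition bigO_N (R : realType) (d : nat) (C : R)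
    (u v : nat -> nat -> d.-tuple R -> R) : Prop :=
  (limn_esup (fun N : nat =>
     ereal_sup [set (`|u N np.1 np.2 / v N np.1 np.2|)%:E | np in
       [set np : nat * d.-tuple R | admissible N np.1 np.2]]) < C%:E)%E.

Definition nu (R : realType) (x : R) : R := (Num.ceil (x^-1 - 1))%:~R.

Definition deviation_sum (R : realType) (d : nat) (n : nat) (p : d.-tuple R) : R :=
  \sum_(i < d.+1)
    let q := tnth (pbar p) i in let nuq := nu q in
    (1 / nuq) `^ (n%:R * nuq * q) *
    ((1 - q) / (1 - nuq * q)) `^ (n%:R * (1 - nuq * q)).

Definition max_pbar (R : realType) (d : nat) (p : d.-tuple R) : R :=
  \big[Num.max/tnth (pbar p) ord_max]_(i < d.+1) tnth (pbar p) i.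

Definition min_pbar (R : realType) (d : nat) (p : d.-tuple R) : R :=
  \big[Num.min/tnth (pbar p) ord_max]_(i < d.+1) tnth (pbar p) i.

(* Main.v *)
Require Import Defs.
From HB Require Import structures.
From mathcomp Require Import all_boot all_order all_algebra.
From mathcomp Require Import ring lra.
From mathcomp Require Import all_classical all_reals all_analysis.
From mathcomp Require Import measurable_realfun.

(** Write [m_i = n p_i], [P] and [Q] for the hypergeometric and multinomial
    weights and [phi] for the normal density. The law of [X] has a density,
    equal to [P k] on the unit cell centred at the lattice point [k]. Two
    probability densities [f] and [g] satisfy
    [int |f - g| = 2 int (f - g)^+], so the distance to bound is at most twice
    the sum over the cells of [int (P k - phi)^+] ([tv_norm_le_sum_excess]),
    and [(P k - phi)^+ <= (P k - Q k)^+ + (Q k - phi)^+] separates the two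
    errors.

    Hypergeometric against multinomial. A sample drawn with replacement has
    distinct elements with probability [rho = N (N - 1) ... (N - n + 1) / N^n],
    and is then distributed as a sample drawn without replacement. Hence
    [rho P <= Q], and [2 sum (P - Q)^+ <= 2 (1 - rho) <= min (2, n^2 / N)],
    which is at most [sqrt (2 n^2 / N)] ([sum_excess_hypergeometric]).

    Multinomial against normal. A Pinsker-type inequality
    ([integral_excess_le_entropy]) bounds [sum int (Q k - phi)^+] by
    [sqrt (2 kappa)], where [kappa] bounds the entropy of [Q] relative to
    [phi], averaged over the cells. The normal density factors like the
    multinomial weights: it is the density of independent normal variables of
    variances [m_1, ..., m_{d+1}] given their sum ([mvnormal_pdf_gauss_prod]).
    So [ln (Q k / phi)] is a sum of [d + 1] one-dimensional terms, up to the
    normalizing factors of the sum. In each of them Stirling's formula produces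
    a quadratic term that the exponent of [phi] cancels, and the rest is bounded
    by a cubic polynomial in [k_i - m_i] ([log_ratio_term_le]). That bound holds
    for every natural number [k_i], so no tail estimate is involved: taking the
    mean only uses the first three central moments of a binomial law, and
    leaves [O(1 / m_i)] ([mean_log_ratio_term]). The displacement [v] inside a
    cell moves the last coordinate by [- (v_1 + ... + v_d)], of variance
    [d / 12], which adds [O(d / m_{d+1})]. As the largest [p_i] is at least
    [1 / (d + 1)], all [1 / m_i] are at most [2 d max / (n min)]
    ([inv_pbar_le]), and so [kappa = O(d^2 max / (n min))], with a constant
    that does not depend on [d]. These estimates need all [m_i >= 1];
    otherwise the claimed bound exceeds [2], the largest possible distance. *)

Import Order.TTheory GRing.Theory Num.Theory.
Import numFieldNormedType.Exports.

Set Implicit Arguments.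
Unset Strict Implicit.
Unset Printing Implicit Defensive.

Local Open Scope classical_set_scope.
Local Open Scope ring_scope.

(** * Taylor bounds for the logarithm *)

Section log_inequalities.
Context {R : realType}.
Implicit Types x y z u : R.

Lemma MVT_pos (f df : R -> R) x y : 0 < x -> x <= y ->
  (forall z, 0 < z -> is_derive z (1 : R) f (df z)) ->
  exists2 c, x <= c <= y & f y - f x = df c * (y - x).
Proof.
move=> x0 xy Df.
have [||c cxy ->] := @MVT_segment R f df x y xy.
- by move=> z; rewrite in_itv/= => /andP[xz _]; apply: Df; exact: lt_trans xz.
- apply: continuous_in_subspaceT => z.
  rewrite inE/= in_itv/= => /andP[xz _].
  have [+ _] : is_derive z (1 : R) f (df z) by apply: Df; exact: lt_le_trans xz.
  by move=> /derivable1_diffP/differentiable_continuous.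
- by exists c => //; move: cxy; rewrite in_itv.
Qed.

Lemma is_derive_pos_ndecr (f df : R -> R) :
  (forall z, 0 < z -> is_derive z (1 : R) f (df z)) ->
  (forall z, 0 < z -> 0 <= df z) ->
  forall x y, 0 < x -> x <= y -> f x <= f y.
Proof.
move=> Df df0 x y x0 xy; rewrite -subr_ge0.
have [c /andP[xc _] ->] := MVT_pos x0 xy Df.
by rewrite mulr_ge0 ?subr_ge0// df0// (lt_le_trans x0).
Qed.

Lemma ln_le_sub1 x : 0 < x -> ln x <= x - 1.
Proof. by move=> x0; rewrite -{1}(subrKC 1 x); apply: le_ln1Dx; lra. Qed.

Definition ln_taylor2 x := ln x - ((x - 1) - (x - 1) ^+ 2 / 2).

(** The derivative is [(x - 1) ^ 2 / x]. Monotonicity gives the sign of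
    [ln_taylor2] on both sides of its zero [1]. *)
Lemma ln_taylor2_ndecr x y : 0 < x -> x <= y -> ln_taylor2 x <= ln_taylor2 y.
Proof.
apply: (@is_derive_pos_ndecr ln_taylor2 (fun z => z^-1 - (1 - (z - 1)))) => z z0.
  rewrite /ln_taylor2.
  have := is_derive1_ln z0 => dln.
  by apply: is_derive_eq; rewrite /GRing.scale/= ?(mulr0, add0r, subr0, mulr1); lra.
suff -> : z^-1 - (1 - (z - 1)) = (z - 1) ^+ 2 / z.
  by rewrite mulr_ge0 ?sqr_ge0// invr_ge0 ltW.
by field; rewrite gt_eqF.
Qed.

Lemma ln_taylor2_1 : ln_taylor2 1 = 0.
Proof. by rewrite /ln_taylor2 ln1; ring. Qed.

Lemma ln1D_ge u : 0 <= u -> u - u ^+ 2 / 2 <= ln (1 + u).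
Proof.
move=> u0; have : ln_taylor2 1 <= ln_taylor2 (1 + u).
  by apply: ln_taylor2_ndecr => //; lra.
by rewrite ln_taylor2_1 /ln_taylor2 (addrC 1) addrK; lra.
Qed.

Lemma ln1B_le u : 0 <= u < 1 -> ln (1 - u) <= - u - u ^+ 2 / 2.
Proof.
move=> /andP[u0 u1]; have : ln_taylor2 (1 - u) <= ln_taylor2 1.
  by apply: ln_taylor2_ndecr; lra.
rewrite ln_taylor2_1 /ln_taylor2 (_ : 1 - u - 1 = - u); last by ring.
by rewrite sqrrN; lra.
Qed.

Lemma is_derive_xlnx z : 0 < z -> is_derive z (1 : R) (fun x => x * ln x) (ln z + 1).
Proof.
move=> z0; have dln := is_derive1_ln z0.
by apply: is_derive_eq; rewrite /GRing.scale/= mulfV ?gt_eqF//; ring.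
Qed.

(** The derivative is [ln x - (x - 1) <= 0]. *)
Lemma xlnx_taylor2_nincr x y : 0 < x -> x <= y ->
  y * ln y - y - (y - 1) ^+ 2 / 2 <= x * ln x - x - (x - 1) ^+ 2 / 2.
Proof.
move=> x0 xy; rewrite -lerN2.
apply: (@is_derive_pos_ndecr (fun y => - (y * ln y - y - (y - 1) ^+ 2 / 2))
   (fun z => - (ln z + 1 - 1 - (z - 1)))) xy => // z z0.
  have dln := is_derive_xlnx z0.
  by apply: is_derive_eq; rewrite /GRing.scale/= ?(mulr0, add0r, subr0, mulr1); lra.
by have := ln_le_sub1 z0; lra.
Qed.

(** The Taylor polynomial of degree 3 at 1 bounds [x ln x] from below on the
    whole half-line because the fourth derivative of [x ln x] is positive.
    Here this is read off from the derivative [ln_taylor2] of the difference,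
    which has the sign of [x - 1]. *)
Lemma xlnx_taylor3_ge x : 0 < x ->
  (x - 1) ^+ 2 / 2 - (x - 1) ^+ 3 / 6 <= x * ln x - x + 1.
Proof.
move=> x0.
pose f y : R := y * ln y - y + 1 - ((y - 1) ^+ 2 / 2 - (y - 1) ^+ 3 / 6).
have Df z : 0 < z -> is_derive z (1 : R) f (ln_taylor2 z).
  move=> z0; have dln := is_derive_xlnx z0.
  by rewrite /f; apply: is_derive_eq; rewrite /ln_taylor2 /GRing.scale/=; field.
suff : f 1 <= f x by rewrite /f ln1; lra.
rewrite -subr_ge0; have [x1|/ltW x1] := leP 1 x.
  have [c /andP[c1 _] ->] := MVT_pos ltr01 x1 Df.
  apply: mulr_ge0; last by rewrite subr_ge0.
  by rewrite -ln_taylor2_1; exact: ln_taylor2_ndecr.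
have [c /andP[xc c1] fE] := MVT_pos x0 x1 Df.
rewrite -opprB fE -mulNr; apply: mulr_ge0; last by rewrite subr_ge0.
by rewrite oppr_ge0 -ln_taylor2_1; apply: ln_taylor2_ndecr => //; exact: lt_le_trans xc.
Qed.

End log_inequalities.

(** * Stirling's formula with explicit error *)

Section stirling.
Context {R : realType}.
Implicit Types (k : nat) (x u : R).

Definition half_shift k : R := k%:R + 1 / 2.

Lemma half_shift_gt0 k : 0 < half_shift k.
Proof. by rewrite /half_shift; have : 0 <= k%:R :> R by []; lra. Qed.

(** The remainder in Stirling's formula, taken at the half-integer [k + 1/2]:
    in this form it is monotone and the formula makes sense at [k = 0]. *)
Definition stirling_rem k : R :=
  ln k`!%:R - (half_shift k * ln (half_shift k) - half_shift k).

Lemma stirling_remS k (K := k.+1%:R : R) (u := (2 * K)^-1) :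
  stirling_rem k.+1 - stirling_rem k =
  1 - K * ((1 + u) * ln (1 + u) - (1 - u) * ln (1 - u)).
Proof.
have K0 : 0 < K by rewrite ltr0n.
have K1 : 1 <= K by rewrite ler1n.
have Ku : K * u = 1 / 2 by rewrite /u; field; rewrite gt_eqF.
have u0 : 0 < u by rewrite invr_gt0; lra.
have u1 : u <= 1 / 2 by rewrite -Ku ler_peMl// ltW.
have hS : half_shift k.+1 = K * (1 + u) by rewrite mulrDr Ku mulr1.
have hk : half_shift k = K * (1 - u).
  by rewrite mulrBr Ku mulr1 /half_shift /K -(natr1 k); lra.
have lnS : ln (half_shift k.+1) = ln K + ln (1 + u).
  by rewrite hS lnM// posrE; lra.
have lnk : ln (half_shift k) = ln K + ln (1 - u).
  by rewrite hk lnM// posrE; lra.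
have lnf : ln k.+1`!%:R = ln K + ln k`!%:R :> R.
  by rewrite factS natrM lnM// posrE ltr0n// fact_gt0.
rewrite /stirling_rem lnf lnS lnk hS hk.
rewrite [in RHS]mulrBr !(mulrA K).
rewrite (_ : K * (1 + u) = K + 1 / 2); last by rewrite mulrDr Ku mulr1.
rewrite (_ : K * (1 - u) = K - 1 / 2); last by rewrite mulrBr Ku mulr1.
by field.
Qed.

(** Concavity of the logarithm: [ln K] is at least its mean over
    [[K - 1/2, K + 1/2]]. *)
Lemma stirling_rem_leS k : stirling_rem k <= stirling_rem k.+1.
Proof.
rewrite -subr_ge0 stirling_remS; set K := k.+1%:R; set u := (2 * K)^-1.
have K0 : 0 < K :> R by rewrite ltr0n.
have K1 : 1 <= K :> R by rewrite ler1n.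
have Ku : K * u = 1 / 2 by rewrite /u; field; rewrite gt_eqF.
have u0 : 0 < u by rewrite invr_gt0; lra.
have u1 : u <= 1 / 2 by rewrite -Ku ler_peMl// ltW.
have := @xlnx_taylor2_nincr R 1 (1 + u) ltr01.
have := @xlnx_taylor2_nincr R (1 - u) 1.
rewrite ln1 !mulr0 => /(_ _ _) h1 /(_ _) h2.
have {}h1 := h1 ltac:(lra) ltac:(lra).
have {}h2 := h2 ltac:(lra).
suff : (1 + u) * ln (1 + u) - (1 - u) * ln (1 - u) <= 2 * u.
  by rewrite -(ler_pM2l K0) mulrCA Ku; lra.
have e1 : (1 + u - 1) ^+ 2 = (1 - u - 1) ^+ 2 by ring.
by move: h1 h2; rewrite e1; lra.
Qed.

(** The right-hand side of [stirling_remS] is at most [1 / (8 K ^ 2)], hence at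
    most [1 / (4 K) - 1 / (4 (K + 1))], which telescopes. *)
Lemma stirling_remS_le k :
  stirling_rem k.+1 + 1 / (4 * k.+2%:R) <= stirling_rem k + 1 / (4 * k.+1%:R).
Proof.
rewrite -lerBrDr -addrA addrC -lerBlDr.
rewrite stirling_remS; set K := k.+1%:R; set u := (2 * K)^-1.
have K0 : 0 < K :> R by rewrite ltr0n.
have K1 : 1 <= K :> R by rewrite ler1n.
have KS : k.+2%:R = K + 1 :> R by rewrite -(natr1 k.+1).
have Ku : K * u = 1 / 2 by rewrite /u; field; rewrite gt_eqF.
have u0 : 0 < u by rewrite invr_gt0; lra.
have u1 : u <= 1 / 2 by rewrite -Ku ler_peMl// ltW.
have h1 := @ln1D_ge R u (ltW u0).
have h2 : ln (1 - u) <= - u - u ^+ 2 / 2 by apply: ln1B_le; apply/andP; split; lra.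
have {}h1 : (1 + u) * (u - u ^+ 2 / 2) <= (1 + u) * ln (1 + u).
  by rewrite ler_pM2l//; lra.
have {}h2 : (1 - u) * ln (1 - u) <= (1 - u) * (- u - u ^+ 2 / 2).
  by rewrite ler_pM2l//; lra.
have h : 2 * u - u ^+ 3 <= (1 + u) * ln (1 + u) - (1 - u) * ln (1 - u).
  have -> : 2 * u - u ^+ 3 =
      (1 + u) * (u - u ^+ 2 / 2) - (1 - u) * (- u - u ^+ 2 / 2) by field.
  lra.
move: h; rewrite -(ler_pM2l K0) => h.
have e : K * (2 * u - u ^+ 3) = 1 - 1 / (8 * K ^+ 2).
  by rewrite /u; field; rewrite gt_eqF.
rewrite e in h.
apply: le_trans (_ : 1 / (8 * K ^+ 2) <= _); first by rewrite lerBlDr -lerBlDl.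
rewrite KS (_ : 1 / (4 * K) - _ = 1 / (4 * K * (K + 1))); last first.
  by field; do ?[apply/andP; split]; rewrite gt_eqF//; lra.
rewrite !div1r lef_pV2 ?posrE; [|nra..].
by nra.
Qed.

Lemma stirling_rem_ndecr k j : (k <= j)%N -> stirling_rem k <= stirling_rem j.
Proof.
move=> /subnKC <-; elim: (j - k)%N => [|i ih]; first by rewrite addn0.
by rewrite addnS (le_trans ih)// stirling_rem_leS.
Qed.

Lemma stirling_rem_corr_nincr k j : (k <= j)%N ->
  stirling_rem j + 1 / (4 * j.+1%:R) <= stirling_rem k + 1 / (4 * k.+1%:R).
Proof.
move=> /subnKC <-; elim: (j - k)%N => [|i ih]; first by rewrite addn0.
by rewrite addnS (le_trans _ ih)// stirling_remS_le.
Qed.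

Local Notation mu := (@lebesgue_measure R).
(** These integrals bring [pi] into the constant of Stirling's formula. *)
Definition wallis n : R := \int[mu]_(x in `[0, pi / 2]) (sin x ^+ n).

Let cont_sinX n : continuous (fun x : R => sin x ^+ n).
Proof.
move=> x; apply: (@continuous_comp _ _ _ sin (fun y => y ^+ n)).
  exact: continuous_sin.
exact: exprn_continuous.
Qed.

Let int_sinX n : mu.-integrable `[0, pi / 2] (EFin \o (fun x => sin x ^+ n)).
Proof.
apply: continuous_compact_integrable; first exact: segment_compact.
exact: continuous_subspaceT.
Qed.

Lemma wallis_FTC (f F : R -> R) : continuous f ->
  (forall x, is_derive x (1 : R) F (f x)) ->
  \int[mu]_(x in `[0, pi / 2]) f x = F (pi / 2) - F 0.
Proof.
move=> cf dF.
have cF : continuous F.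
  by move=> x; apply/differentiable_continuous/derivable1_diffP; have [] := dF x.
rewrite /Rintegral (@continuous_FTC2 _ f F)//.
- by rewrite divr_gt0// pi_gt0.
- exact: continuous_subspaceT.
- split.
  + by move=> x _; have [] := dF x.
  + by apply: cvg_at_right_filter; exact: cF.
  + by apply: cvg_at_left_filter; exact: cF.
- by move=> x _; rewrite derive1E; have [] := dF x.
Qed.

Lemma wallis0 : wallis 0 = pi / 2.
Proof.
rewrite /wallis; under eq_Rintegral do rewrite expr0.
rewrite (@wallis_FTC (fun=> 1) id) ?subr0//; first exact: cst_continuous.
Qed.

Lemma wallis1 : wallis 1 = 1.
Proof.
rewrite /wallis; under eq_Rintegral do rewrite expr1.
have dF x : is_derive x (1 : R) (fun x => - cos x) (sin x).
  by apply: is_derive_eq; rewrite opprK.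
by rewrite (wallis_FTC (@continuous_sin R) dF) cos0 cos_pihalf; ring.
Qed.

Lemma wallisSS n : n.+2%:R * wallis n.+2 = n.+1%:R * wallis n.
Proof.
pose f x : R := n.+2%:R * sin x ^+ n.+2 - n.+1%:R * sin x ^+ n.
have cf : continuous f.
  by move=> x; apply: cvgB; apply: cvgM; try exact: cvg_cst; exact: cont_sinX.
(* [f] has the primitive [- cos x * sin x ^ (n + 1)], which vanishes at both
   ends. *)
have dF x : is_derive x (1 : R) (fun x => - (cos x * sin x ^+ n.+1)) (f x).
  have dsin : is_derive x (1 : R) (fun y => sin y ^+ n.+1)
      (n.+1%:R * sin x ^+ n * cos x).
    have := @is_deriveX _ _ sin n.+1 x 1 (cos x) (is_derive_sin x).
    by rewrite exprfctE.
  apply: is_derive_eq; rewrite /GRing.scale/=.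
  rewrite (_ : - (_ + _) =
    - (n.+1%:R * sin x ^+ n * (cos x * cos x)) + sin x ^+ n.+2).
    have -> : cos x * cos x = 1 - sin x ^+ 2 by rewrite -(cos2Dsin2 x); ring.
    by rewrite /f -(natr1 n.+1) !exprS; ring.
  by rewrite !exprS; ring.
have : \int[mu]_(x in `[0, pi / 2]) f x = 0.
  by rewrite (wallis_FTC cf dF) cos_pihalf sin0 !exprS !mul0r mulr0; ring.
rewrite RintegralB//; last 2 first.
- by apply: (integrableZl _ _ (int_sinX n.+2)).
- by apply: (integrableZl _ _ (int_sinX n)).
rewrite !RintegralZl//.
by move/eqP; rewrite subr_eq0 => /eqP.
Qed.

Lemma wallis_leS n : wallis n.+1 <= wallis n.
Proof.
apply: le_Rintegral.
- by [].
- exact: int_sinX.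
- exact: int_sinX.
- move=> x; rewrite /= in_itv/= => /andP[x0 x1].
  have s0 : 0 <= sin x.
    apply: sin_ge0_pi; rewrite x0/= (le_trans x1)// ler_pdivrMr//.
    by have := pi_gt0 R; lra.
  by rewrite exprS ler_piMl ?exprn_ge0// sin_le1.
Qed.

Lemma wallis_evenE k :
  wallis k.*2 * (2 ^+ k * k`!%:R) ^+ 2 = pi / 2 * (k.*2)`!%:R.
Proof.
elim: k => [|k ih]; first by rewrite wallis0 !fact0 expr0 mulr1 expr1n mulr1.
have e : k.*2.+2%:R = 2 * k.+1%:R :> R by rewrite -doubleS -mul2n natrM.
rewrite doubleS !factS !natrM (exprS _ k).
transitivity (k.*2.+2%:R * (k.*2.+2%:R * wallis k.*2.+2) * (2 ^+ k * k`!%:R) ^+ 2).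
  by rewrite e; ring.
rewrite wallisSS.
transitivity (k.*2.+2%:R * k.*2.+1%:R * (wallis k.*2 * (2 ^+ k * k`!%:R) ^+ 2)).
  by ring.
by rewrite ih; ring.
Qed.

Lemma wallis_oddE k :
  wallis k.*2.+1 * (k.*2.+1)`!%:R = (2 ^+ k * k`!%:R) ^+ 2.
Proof.
elim: k => [|k ih]; first by rewrite wallis1 !fact0 expr0 mulr1 expr1n.
have e : k.*2.+2%:R = 2 * k.+1%:R :> R by rewrite -doubleS -mul2n natrM.
rewrite doubleS (factS k) (factS k.*2.+2) (factS k.*2.+1).
move: (k.*2.+1)`! ih => F ih; rewrite !natrM.
transitivity (k.*2.+3%:R * wallis k.*2.+3 * (k.*2.+2%:R * F%:R)).
  by rewrite mulrCA mulrA.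
rewrite wallisSS.
transitivity (k.*2.+2%:R ^+ 2 * (wallis k.*2.+1 * F%:R)); first by rewrite mulrACA -expr2.
by rewrite ih e (exprS _ k); ring.
Qed.

(** This is [4 ^ k / 'C(2 k, k)]. *)
Definition central_ratio k : R := (2 ^+ k * k`!%:R) ^+ 2 / (k.*2)`!%:R.

Lemma central_ratio_gt0 k : 0 < central_ratio k.
Proof.
by rewrite divr_gt0 ?exprn_gt0 ?mulr_gt0 ?exprn_gt0// ltr0n fact_gt0.
Qed.

Lemma wallis_even k : wallis k.*2 = pi / 2 / central_ratio k.
Proof.
have f0 : (k.*2)`!%:R != 0 :> R by rewrite pnatr_eq0 -lt0n fact_gt0.
have p0 : (2 ^+ k * k`!%:R) ^+ 2 != 0 :> R.
  by rewrite gt_eqF// exprn_gt0// mulr_gt0 ?exprn_gt0// ltr0n fact_gt0.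
apply: (mulIf p0); rewrite wallis_evenE /central_ratio; move: p0.
by set a := _ ^+ 2 => p0; field; rewrite f0 p0.
Qed.

Lemma wallis_odd k : wallis k.*2.+1 = central_ratio k / k.*2.+1%:R.
Proof.
have f0 : (k.*2.+1)`!%:R != 0 :> R by rewrite pnatr_eq0 -lt0n fact_gt0.
apply: (mulIf f0); rewrite wallis_oddE /central_ratio factS natrM.
move: f0; rewrite factS natrM mulf_eq0 negb_or => /andP[f0 f1].
by set a := _ ^+ 2; field; rewrite ?f0 ?f1 ?andbT.
Qed.

Lemma central_ratio_ub k : central_ratio k ^+ 2 <= pi * half_shift k.
Proof.
have c0 := central_ratio_gt0 k.
have := wallis_leS k.*2; rewrite wallis_even wallis_odd.
rewrite ler_pdivrMr ?ltr0n// mulrAC ler_pdivlMr// -expr2 => /le_trans; apply.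
by rewrite /half_shift -(natr1 k.*2) -mul2n natrM; lra.
Qed.

Lemma central_ratio_lb k : pi * k%:R <= central_ratio k ^+ 2.
Proof.
have c0 := central_ratio_gt0 k.
case: k c0 => [|k] c0; first by rewrite mulr0 sqr_ge0.
have e : k.+1.*2%:R = 2 * k.+1%:R :> R by rewrite -mul2n natrM.
have w : k.+1.*2%:R * wallis k.*2.+1 = central_ratio k.+1.
  have := wallis_odd k.+1; rewrite doubleS -wallisSS => ->.
  by rewrite mulrC divfK// pnatr_eq0.
have := wallis_leS k.*2.+1; rewrite -doubleS wallis_even.
rewrite -(ler_pM2l (_ : 0 < k.+1.*2%:R)) ?ltr0n// w.
by rewrite mulrA ler_pdivrMr// -expr2 e; lra.
Qed.

Lemma ln_central_ratio k : ln (central_ratio k) =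
  2 * stirling_rem k - stirling_rem k.*2 - ln 2 / 2 + ln (half_shift k) / 2
  + half_shift k.*2 * (ln (half_shift k) - ln (half_shift k - 1 / 4)) - 1 / 2.
Proof.
have h0 := half_shift_gt0 k.
have h4 : 0 < half_shift k - 1 / 4.
  by rewrite /half_shift; have : 0 <= k%:R :> R by []; lra.
have f0 : 0 < k`!%:R :> R by rewrite ltr0n fact_gt0.
have e2 : half_shift k.*2 = 2 * (half_shift k - 1 / 4).
  by rewrite /half_shift -mul2n natrM; lra.
have e3 : k%:R = half_shift k - 1 / 2 by rewrite /half_shift; lra.
have f2 : 0 < (k.*2)`!%:R :> R by rewrite ltr0n fact_gt0.
have p2 : 0 < 2 ^+ k :> R by rewrite exprn_gt0.
have pf : 0 < 2 ^+ k * k`!%:R :> R by rewrite mulr_gt0.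
have lnc : ln (central_ratio k) =
    2 * (k%:R * ln 2 + ln k`!%:R) - ln (k.*2)`!%:R.
  rewrite /central_ratio ln_div ?posrE ?exprn_gt0// lnXn// lnM ?posrE// lnXn//.
  by rewrite !mulr_natl.
have ln2h : ln (half_shift k.*2) = ln 2 + ln (half_shift k - 1 / 4).
  by rewrite e2 lnM ?posrE.
by rewrite lnc /stirling_rem ln2h e2 e3; field.
Qed.

(** The Wallis bounds [pi k <= central_ratio k ^ 2 <= pi (k + 1 / 2)] pin down
    [2 stirling_rem k - stirling_rem (2 k)] up to [O(1 / k)], and by
    [stirling_rem_ndecr] and [stirling_rem_corr_nincr] this difference is
    [stirling_rem k] up to [O(1 / k)]. *)
Lemma stirling_rem_approx_ub k : (0 < k)%N ->
  stirling_rem k <= ln (2 * pi) / 2 + 1 / k%:R.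
Proof.
move=> k0; have K0 : 1 <= k%:R :> R by rewrite ler1n.
have c0 := central_ratio_gt0 k.
have h0 := half_shift_gt0 k.
have hk : half_shift k - 1 / 4 = k%:R + 1 / 4 by rewrite /half_shift; lra.
have hk0 : 0 < half_shift k - 1 / 4 by lra.
have e2 : half_shift k.*2 = 2 * (half_shift k - 1 / 4).
  by rewrite /half_shift -mul2n natrM; lra.
have lnc : 2 * ln (central_ratio k) <= ln pi + ln (half_shift k).
  rewrite mulr_natl -lnXn// -lnM ?posrE ?pi_gt0// ler_ln ?posrE ?exprn_gt0//.
    exact: central_ratio_ub.
  by rewrite mulr_gt0 ?pi_gt0.
have rem2 : stirling_rem k.*2 <= stirling_rem k + 1 / (4 * k.+1%:R).
  apply: le_trans (stirling_rem_corr_nincr (_ : k <= k.*2)%N).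
    by rewrite lerDl divr_ge0// mulr_ge0.
  by rewrite -addnn leq_addl.
have ln_diff : 1 / 2 - 1 / (8 * k%:R) <=
    half_shift k.*2 * (ln (half_shift k) - ln (half_shift k - 1 / 4)).
  set v := 1 / (4 * half_shift k).
  have v0 : 0 < v by rewrite divr_gt0 ?mulr_gt0.
  have -> : ln (half_shift k) - ln (half_shift k - 1 / 4) = - ln (1 - v).
    rewrite (_ : half_shift k - 1 / 4 = half_shift k * (1 - v)); last first.
      by rewrite /v; field; rewrite gt_eqF.
    rewrite lnM ?posrE//; first by ring.
    rewrite subr_gt0 /v ltr_pdivrMr ?mulr_gt0// mul1r.
    by rewrite /half_shift; lra.
  have h1 : v <= - ln (1 - v).
    have : ln (1 - v) <= 1 - v - 1.
      apply: ln_le_sub1; rewrite subr_gt0 /v ltr_pdivrMr ?mulr_gt0// mul1r.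
      by rewrite /half_shift; lra.
    by lra.
  apply: le_trans (ler_wpM2l _ h1); last by rewrite ltW// half_shift_gt0.
  rewrite e2 hk /v /half_shift.
  rewrite -subr_ge0 (_ : _ - _ = 1 / (8 * k%:R) - 1 / (8 * k%:R + 4)).
    rewrite subr_ge0 !div1r lef_pV2 ?posrE; lra.
  by field; apply/andP; split; rewrite gt_eqF//; lra.
have i1 : 1 / (4 * k.+1%:R) <= 1 / (4 * k%:R) :> R.
  by rewrite !div1r lef_pV2 ?posrE ?mulr_gt0 ?ltr0n// ler_pM2l// ler_nat.
have i2 : 1 / (4 * k%:R) = 1 / 4 * (1 / k%:R) :> R by field; rewrite gt_eqF//; lra.
have i3 : 1 / (8 * k%:R) = 1 / 8 * (1 / k%:R) :> R by field; rewrite gt_eqF//; lra.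
have lnp : ln (2 * pi) = ln 2 + ln pi :> R by rewrite lnM ?posrE ?pi_gt0.
have i0 : 0 <= 1 / k%:R :> R by rewrite divr_ge0.
have cE := ln_central_ratio k.
rewrite i3 in ln_diff; rewrite i2 in i1.
move: (1 / k%:R) (1 / (4 * k.+1%:R)) (half_shift k.*2 * _) cE ln_diff rem2 i1 i0 => x y z.
by rewrite lnp; lra.
Qed.

Lemma stirling_rem_approx_lb k : (0 < k)%N ->
  ln (2 * pi) / 2 - 1 / k%:R <= stirling_rem k.
Proof.
move=> k0; have K0 : 1 <= k%:R :> R by rewrite ler1n.
have c0 := central_ratio_gt0 k.
have h0 := half_shift_gt0 k.
have hk : half_shift k - 1 / 4 = k%:R + 1 / 4 by rewrite /half_shift; lra.
have hk0 : 0 < half_shift k - 1 / 4 by lra.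
have e2 : half_shift k.*2 = 2 * (half_shift k - 1 / 4).
  by rewrite /half_shift -mul2n natrM; lra.
have lnc : ln pi + ln k%:R <= 2 * ln (central_ratio k).
  rewrite mulr_natl -lnXn// -lnM ?posrE ?pi_gt0 ?ltr0n//.
  rewrite ler_ln ?posrE ?exprn_gt0// ?mulr_gt0 ?pi_gt0 ?ltr0n//.
  exact: central_ratio_lb.
have rem2 : stirling_rem k <= stirling_rem k.*2.
  by apply: stirling_rem_ndecr; rewrite -addnn leq_addl.
have ln_diff : half_shift k.*2 * (ln (half_shift k) - ln (half_shift k - 1 / 4))
    <= 1 / 2.
  set v := 1 / (4 * (half_shift k - 1 / 4)).
  have v0 : 0 < v by rewrite divr_gt0 ?mulr_gt0.
  have -> : ln (half_shift k) - ln (half_shift k - 1 / 4) = ln (1 + v).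
    rewrite (_ : half_shift k = (half_shift k - 1 / 4) * (1 + v)) ?addrK; last first.
      by rewrite /v; field; rewrite gt_eqF//; lra.
    rewrite lnM ?posrE//; last by lra.
    rewrite (_ : _ * (1 + v) - 1 / 4 = half_shift k - 1 / 4); first by ring.
    by rewrite /v; field; rewrite gt_eqF//; lra.
  have h1 : ln (1 + v) <= v by apply: le_ln1Dx; lra.
  apply: le_trans (ler_wpM2l _ h1) _; first by rewrite ltW// half_shift_gt0.
  by rewrite e2 /v -subr_ge0 (_ : _ - _ = 0)//; field; rewrite gt_eqF//; lra.
have lnk : ln (half_shift k) <= ln k%:R + 1 / (2 * k%:R).
  rewrite (_ : half_shift k = k%:R * (1 + 1 / (2 * k%:R))).
    have i0 : 0 <= 1 / (2 * k%:R) :> R by rewrite divr_ge0// mulr_ge0.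
    have p0 : 0 < 1 + 1 / (2 * k%:R) :> R by rewrite ltr_wpDr.
    have k0R : 0 < k%:R :> R by rewrite ltr0n.
    rewrite lnM ?posrE//.
    by rewrite lerD2l; apply: le_ln1Dx; rewrite (lt_le_trans _ i0)// ltrN10.
  by rewrite /half_shift; field; rewrite gt_eqF//; lra.
have i0 : 0 <= 1 / k%:R :> R by rewrite divr_ge0.
have i2 : 1 / (2 * k%:R) = 1 / 2 * (1 / k%:R) :> R by field; rewrite gt_eqF//; lra.
have lnp : ln (2 * pi) = ln 2 + ln pi :> R by rewrite lnM ?posrE ?pi_gt0.
have cE := ln_central_ratio k.
rewrite i2 in lnk.
move: (1 / k%:R) (half_shift k.*2 * _) cE ln_diff lnk i0 => x y.
by rewrite lnp; lra.
Qed.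

Lemma le_of_inv_nat (x y : R) (k0 : nat) :
  (forall k, (0 < k)%N -> (k0 <= k)%N -> x <= y + 1 / k%:R) -> x <= y.
Proof.
move=> h; apply/ler_addgt0Pr => e e0.
pose k := (maxn k0 (Num.truncn (1 / e)).+1).
have kpos : (0 < k)%N by rewrite leq_max ltn0Sn orbT.
apply: le_trans (h k kpos (leq_maxl _ _)) _; rewrite lerD2l.
rewrite ler_pdivrMr ?ltr0n// mulrC -ler_pdivrMr// ltW//.
apply: lt_le_trans (_ : (Num.truncn (1 / e)).+1%:R <= _).
  by rewrite truncnS_gt.
by rewrite ler_nat leq_maxr.
Qed.

(** The remainder increases, and exceeds the bound by at most [1 / j] at [j]. *)
Lemma stirling_rem_ub k : stirling_rem k <= ln (2 * pi) / 2.
Proof.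
apply: (@le_of_inv_nat _ _ k) => j j0 kj.
exact: le_trans (stirling_rem_ndecr kj) (stirling_rem_approx_ub j0).
Qed.

Lemma stirling_rem_lb k : ln (2 * pi) / 2 - 1 / (4 * k.+1%:R) <= stirling_rem k.
Proof.
rewrite lerBlDr; apply: (@le_of_inv_nat _ _ k) => j j0 kj.
rewrite -lerBlDr; apply: le_trans (stirling_rem_approx_lb j0) _.
apply: le_trans (stirling_rem_corr_nincr kj).
by rewrite lerDl divr_ge0// mulr_ge0.
Qed.

End stirling.

(** * Moments of the multinomial law *)

Section multinomial_theorem.
Context {R : numFieldType}.

(** A sum over the vectors of sum [n] is the coefficient of ['X^n] in a product
    of exponential series, truncated to make them polynomials. The arguments
    [x] are themselves polynomials, whose variable will generate moments. *)
Definition trunc_exp n (x : {poly R}) : {poly {poly R}} :=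
  \poly_(k < n.+1) (k`!%:R^-1 *: x ^+ k).

Lemma coef_prod_trunc_exp (I : Type) (s : seq I) (x : I -> {poly R}) n j :
  (j <= n)%N -> (\prod_(i <- s) trunc_exp n (x i))`_j =
  j`!%:R^-1 *: (\sum_(i <- s) x i) ^+ j.
Proof.
elim: s j => [|a s ih] j jn.
  rewrite !big_nil coef1; case: j jn => [|j] _.
    by rewrite expr0 fact0 invr1 scale1r.
  by rewrite expr0n/= scaler0.
rewrite !big_cons coefM addrC exprDn scaler_sumr; apply: eq_bigr => i _.
have ij : (i <= j)%N by rewrite -ltnS.
rewrite ih ?(leq_trans (leq_subr _ _))// coef_poly ltnS (leq_trans ij jn).
have scaleMM (b c : R) (u v : {poly R}) : (b *: u) * (c *: v) = (b * c) *: (u * v).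
  by rewrite -scalerAl -scalerAr scalerA.
have scaleMn (b : R) (u : {poly R}) k : b *: (u *+ k) = (b * k%:R) *: u.
  by rewrite -scaler_nat scalerA.
rewrite scaleMM scaleMn [x a ^+ i * _]mulrC.
congr (_ *: _).
have f0 m : m`!%:R != 0 :> R by rewrite pnatr_eq0 -lt0n fact_gt0.
apply: (mulfI (f0 j)); rewrite [RHS]mulVKf//.
by rewrite -(bin_fact ij) !natrM; field; rewrite ?f0.
Qed.

Lemma multinomial_expansion (m n : nat) (x : 'I_m -> {poly R}) :
  \sum_(f : {ffun 'I_m -> 'I_n.+1} | (\sum_i f i == n)%N)
     (\prod_i (f i)`!%:R^-1) *: \prod_i x i ^+ f i =
  n`!%:R^-1 *: (\sum_i x i) ^+ n.
Proof.
rewrite -(@coef_prod_trunc_exp _ _ _ n)//.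
under [in RHS]eq_bigr do rewrite /trunc_exp poly_def.
rewrite bigA_distr_bigA/= coef_sum [in LHS]big_mkcond/=.
apply: eq_bigr => f _.
have -> : \prod_i (((f i)`!%:R^-1 *: x i ^+ f i) *: 'X^(f i)) =
    ((\prod_i (f i)`!%:R^-1) *: \prod_i x i ^+ f i) *: 'X^(\sum_i f i).
  by rewrite scaler_prod scaler_prod prodrXr.
by rewrite coefZ coefXn; case: eqVneq; rewrite ?mulr1 ?mulr0.
Qed.

End multinomial_theorem.

Section multinomial_moments.
Context {R : numFieldType} (m n : nat) (p : 'I_m -> R).
Hypothesis p1 : \sum_i p i = 1.

Definition multinomial_weight (f : {ffun 'I_m -> 'I_n.+1}) : R :=
  n`!%:R / (\prod_i (f i)`!%:R) * \prod_i p i ^+ f i.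

(** Replacing [p_i] by [p_i (1 + 'X)] in the multinomial theorem gives the
    generating function [(1 + p_i 'X) ^ n] of the moments of ['C(f i, j)]. *)
Lemma multinomial_factorial_moment (i : 'I_m) j :
  \sum_(f : {ffun 'I_m -> 'I_n.+1} | (\sum_i f i == n)%N)
    multinomial_weight f * 'C(f i, j)%:R = 'C(n, j)%:R * p i ^+ j.
Proof.
pose x l : {poly R} := p l *: (if l == i then 1 + 'X else 1).
have sx : \sum_l x l = 1 + p i *: 'X.
  rewrite (bigD1 i)//= /x eqxx scalerDr addrAC -[in RHS](scale1r 1) -p1.
  rewrite (bigD1 i (F := p))//= scalerDl; congr (_ + _ + _).
  by rewrite scaler_suml; apply: eq_bigr => l /negbTE ->.
have := congr1 (fun q : {poly R} => n`!%:R * q`_j) (multinomial_expansion n x).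
rewrite coefZ mulVKf ?pnatr_eq0 -?lt0n ?fact_gt0// sx.
have coefX1 (a : R) k : ((1 + a *: 'X) ^+ k)`_j = 'C(k, j)%:R * a ^+ j.
  rewrite exprDn coef_sum.
  under eq_bigr => l _ do
    rewrite expr1n mul1r exprZn coefMn coefZ coefXn.
  have [jk|kj] := leqP j k.
    rewrite (bigD1 (Ordinal (jk : j < k.+1)%N))//= eqxx mulr1 big1 ?addr0.
      by rewrite mulr_natl.
    by move=> l; rewrite -val_eqE/= eq_sym => /negbTE ->; rewrite mulr0 mul0rn.
  rewrite bin_small// mul0r big1// => l _.
  by rewrite gtn_eqF ?mulr0 ?mul0rn// (leq_ltn_trans _ kj)// -ltnS.
rewrite coefX1 => <-; rewrite coef_sum mulr_sumr; apply: eq_bigr => f _.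
rewrite coefZ /multinomial_weight.
have -> : \prod_l x l ^+ f l = (\prod_l p l ^+ f l) *: (1 + 1 *: 'X) ^+ f i.
  under eq_bigr do rewrite /x exprZn.
  rewrite scaler_prod; congr (_ *: _); rewrite (bigD1 i)//= eqxx big1 ?mulr1.
    by rewrite scale1r.
  by move=> l /negbTE ->; rewrite expr1n.
by rewrite coefZ coefX1 expr1n mulr1 prodfV !mulrA.
Qed.

End multinomial_moments.

(** * Integration over tuples *)

Section lebesgue_tuple_theory.
Context {R : realType}.
Local Open Scope ereal_scope.
Local Notation mu := (@lebesgue_measure R).

Lemma integral_lebesgue_tuple0 (f : 0.-tuple R -> \bar R) :
  \int[lebesgue_tuple R 0]_x f x = f [tuple].
Proof.
rewrite integral_dirac// ?diracT ?mul1e//.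
move=> _ Y _; rewrite setTI.
have [fY|fY] := pselect (Y (f [tuple])).
  rewrite (_ : _ @^-1` _ = setT)//.
  by apply/seteqP; split => // x _ /=; rewrite (tuple0 x).
rewrite (_ : _ @^-1` _ = set0)//.
by apply/seteqP; split => // x /=; rewrite (tuple0 x).
Qed.

Lemma integral_lebesgue_tupleS d (f : d.+1.-tuple R -> \bar R) :
  measurable_fun [set: d.+1.-tuple R] f -> (forall x, 0 <= f x) ->
  \int[lebesgue_tuple R d.+1]_x f x =
  \int[mu]_x \int[lebesgue_tuple R d]_y f [tuple of x :: y].
Proof.
move=> mf f0.
transitivity (\int[pushforward (mu \x lebesgue_tuple R d)
    (fun z : R * d.-tuple R => [tuple of z.1 :: z.2])]_x f x); first by [].
rewrite ge0_integral_pushforward//; last exact: measurable_cons_pair.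
rewrite preimage_setT fubini_tonelli1//.
  by apply: measurableT_comp => //; exact: measurable_cons_pair.
by move=> x; exact: f0.
Qed.

Lemma pushforward_lebesgue_measure_shift (c : R) (A : set R) : measurable A ->
  pushforward mu ((fun x => x + c)%R : _ -> measurableTypeR R) A = mu A.
Proof.
move=> mA; apply/esym/lebesgue_measure_unique => //=.
  exact: measurable_funD.
move=> ? _ [[a b]] _ <-; rewrite /pushforward.
rewrite (_ : _ @^-1` _ = `](a - c)%R, (b - c)%R]%classic); last first.
  by apply/seteqP; split => x /=; rewrite !in_itv/= ltrBlDr lerBrDr.
rewrite !lebesgue_measure_itv/= !lte_fin ltrD2r -!EFinB.
by congr (if _ then _%:E else _); ring.
Qed.

Lemma ge0_integral_shift (c : R) (f : R -> \bar R) : measurable_fun setT f ->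
  (forall x, 0 <= f x) -> \int[mu]_x f (x + c)%R = \int[mu]_x f x.
Proof.
move=> mf f0.
have mc : measurable_fun setT (fun x : R => (x + c)%R : measurableTypeR R).
  exact: measurable_funD.
have -> : \int[mu]_x f x = \int[pushforward mu (fun x : R => (x + c)%R : measurableTypeR R)]_x f x.
  apply: eq_measure_integral => A mA _.
  exact/esym/pushforward_lebesgue_measure_shift.
by rewrite ge0_integral_pushforward.
Qed.

Lemma measurable_tuple_add d (c : d.-tuple R) :
  measurable_fun [set: d.-tuple R] (fun x : d.-tuple R => tuple_add x c).
Proof.
apply/measurable_fun_tnthP => i.
rewrite (_ : _ \o _ = (fun x => tnth x i + tnth c i)%R); last first.
  by apply/funext => x /=; rewrite tnth_mktuple.
by apply: measurable_funD => //; exact: measurable_tnth.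
Qed.

Lemma ge0_integral_tuple_add d (c : d.-tuple R) (f : d.-tuple R -> \bar R) :
  measurable_fun [set: d.-tuple R] f -> (forall x, 0 <= f x) ->
  \int[lebesgue_tuple R d]_x f (tuple_add x c) = \int[lebesgue_tuple R d]_x f x.
Proof.
elim: d c f => [|d ih] c f mf f0.
  by apply: eq_integral => x _; congr f; rewrite (tuple0 x) (tuple0 (tuple_add _ _)).
rewrite integral_lebesgue_tupleS//; last first.
  by apply: measurableT_comp => //; exact: measurable_tuple_add.
rewrite integral_lebesgue_tupleS//.
have mf2 x : measurable_fun [set: d.-tuple R] (fun y : d.-tuple R => f [tuple of x :: y]).
  by apply: measurableT_comp => //; exact: measurable_cons.
transitivity (\int[mu]_x \int[lebesgue_tuple R d]_y f [tuple of (x + thead c)%R :: y]).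
  apply: eq_integral => x _; rewrite -[RHS](ih [tuple of behead c])//.
  apply: eq_integral => y _; congr f; apply/eq_from_tnth => i.
  rewrite tnth_mktuple; case: (unliftP ord0 i) => [j|] ->.
    by rewrite !tnthS tnth_mktuple; congr (_ + _)%R; rewrite !(tnth_nth 0%R)/= nth_behead.
  by rewrite !(tnth_nth 0%R)/= /thead (tnth_nth 0%R).
apply: (@ge0_integral_shift _ (fun x => \int[lebesgue_tuple R d]_y f [tuple of x :: y])).
  apply: (@measurable_fun_fubini_tonelli_F _ _ _ _ _ (lebesgue_tuple R d) (fun z => f [tuple of z.1 :: z.2])).
    by apply: measurableT_comp => //; exact: measurable_cons_pair.
  by move=> z; exact: f0.
by move=> x; apply: integral_ge0 => y _; exact: f0.
Qed.

End lebesgue_tuple_theory.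

(** * Normal densities and their convolution *)

Section gaussian.
Context {R : realType}.
Implicit Types (v w x y c s : R).
Local Notation mu := (@lebesgue_measure R).

Definition gauss v x : R := (Num.sqrt (2 * pi * v))^-1 * expR (- x ^+ 2 / (2 * v)).

Lemma gauss_ge0 v x : 0 <= gauss v x.
Proof. by rewrite mulr_ge0 ?expR_ge0// invr_ge0 sqrtr_ge0. Qed.

Lemma gauss_gt0 v x : 0 < v -> 0 < gauss v x.
Proof.
move=> v0; rewrite mulr_gt0 ?expR_gt0// invr_gt0 sqrtr_gt0.
by rewrite !mulr_gt0 ?pi_gt0.
Qed.

Lemma gauss_normal_pdf v c x : 0 < v ->
  gauss v (x - c) = normal_pdf c (Num.sqrt v) x.
Proof.
move=> v0; rewrite normal_pdfE ?gt_eqF ?sqrtr_gt0// /gauss /normal_peak /normal_fun.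
rewrite sqr_sqrtr ?ltW//; congr (_ * expR (_ / _)).
  by congr (Num.sqrt _)^-1; rewrite -mulr_natl; ring.
by rewrite mulr_natl.
Qed.

Lemma integral_gauss v c : 0 < v ->
  (\int[mu]_x (gauss v (x - c))%:E = 1)%E.
Proof.
move=> v0; rewrite -[RHS](@integral_normal_pdf _ c (Num.sqrt v)).
by apply: eq_integral => x _; rewrite gauss_normal_pdf.
Qed.

Lemma measurable_gauss v : measurable_fun [set: R] (gauss v).
Proof.
have m2 : measurable_fun [set: R] (fun x : R => - x ^+ 2 / (2 * v)).
  apply: measurable_funM => //=; apply: measurableT_comp => //=.
by apply: measurable_funM => //=; apply: measurableT_comp => //=.
Qed.

(** Completion of the square in [x]. *)
Lemma gauss_mul v w c s x : 0 < v -> 0 < w ->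
  gauss v (x - c) * gauss w (s + x) =
  gauss (w + v) (s + c) * gauss (v * w / (w + v)) (x - (w * c - v * s) / (w + v)).
Proof.
move=> v0 w0; have vw0 : 0 < w + v by rewrite addr_gt0.
rewrite /gauss mulrACA [RHS]mulrACA -!invfM -!sqrtrM ?mulr_ge0 ?pi_ge0 ?ltW//.
rewrite -!expRD; congr ((Num.sqrt _)^-1 * expR _).
  by field; rewrite gt_eqF.
by field; rewrite ?gt_eqF ?mulr_gt0.
Qed.

(** By [gauss_mul], the integrand is a normal density in [x] times a factor
    that does not depend on [x]. *)
Lemma gauss_convolution v w c s : 0 < v -> 0 < w ->
  (\int[mu]_x (gauss v (x - c) * gauss w (s + x))%:E = (gauss (w + v) (s + c))%:E)%E.
Proof.
move=> v0 w0; have vw0 : 0 < w + v by rewrite addr_gt0.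
under eq_integral => x _ do rewrite gauss_mul// EFinM.
rewrite ge0_integralZl//.
- by rewrite integral_gauss ?mule1// divr_gt0 ?mulr_gt0.
- apply/measurable_EFinP; apply: measurableT_comp; first exact: measurable_gauss.
  exact: measurable_funB.
- by move=> x _; rewrite lee_fin gauss_ge0.
- by rewrite lee_fin gauss_ge0.
Qed.

Lemma measurable_fun_sum_tnth d :
  measurable_fun [set: d.-tuple R] (fun x : d.-tuple R => \sum_(i < d) tnth x i).
Proof. by apply: measurable_sum => i; exact: measurable_tnth. Qed.

Definition gauss_prod d (v c : 'I_d -> R) w s (x : d.-tuple R) : R :=
  (\prod_(i < d) gauss (v i) (tnth x i - c i)) * gauss w (s + \sum_(i < d) tnth x i).

Lemma gauss_prod_ge0 d (v c : 'I_d -> R) w s (x : d.-tuple R) : 0 <= gauss_prod v c w s x.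
Proof.
by rewrite mulr_ge0 ?gauss_ge0//; apply: prodr_ge0 => i _; exact: gauss_ge0.
Qed.

Lemma measurable_gauss_prod d (v c : 'I_d -> R) w s :
  measurable_fun [set: d.-tuple R] (gauss_prod v c w s).
Proof.
apply: measurable_funM.
  apply: measurable_prod => i _; apply: measurableT_comp; first exact: measurable_gauss.
  by apply: measurable_funB => //; exact: measurable_tnth.
apply: measurableT_comp; first exact: measurable_gauss.
by apply: measurable_funD => //; exact: measurable_fun_sum_tnth.
Qed.

(** Integrating out one coordinate at a time, each integral is a convolution
    and adds the variance of that coordinate to [w]. *)
Lemma integral_gauss_prod d (v c : 'I_d -> R) w s :
  (forall i, 0 < v i) -> 0 < w ->
  (\int[lebesgue_tuple R d]_x (gauss_prod v c w s x)%:E =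
  (gauss (w + \sum_(i < d) v i) (s + \sum_(i < d) c i))%:E)%E.
Proof.
elim: d v c w s => [|d ih] v c w s v0 w0.
  by rewrite integral_lebesgue_tuple0 /gauss_prod !big_ord0 mul1r !addr0.
rewrite integral_lebesgue_tupleS; last 2 first.
- by apply/measurable_EFinP; exact: measurable_gauss_prod.
- by move=> x; rewrite lee_fin gauss_prod_ge0.
rewrite !big_ord_recl.
set V := \sum_(i < d) v (lift ord0 i); set S := \sum_(i < d) c (lift ord0 i).
have V0 : 0 <= V by apply: sumr_ge0 => i _; exact: ltW.
transitivity (\int[mu]_x (gauss (v ord0) (x - c ord0) * gauss (w + V) (s + S + x))%:E)%E.
  apply: eq_integral => x _.
  have E (y : d.-tuple R) : gauss_prod v c w s [tuple of x :: y] = gauss (v ord0) (x - c ord0) *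
      gauss_prod (fun i => v (lift ord0 i)) (fun i => c (lift ord0 i)) w (s + x) y.
    rewrite /gauss_prod !big_ord_recl mulrA addrA; congr (_ * _ * gauss _ _).
      by apply: eq_bigr => i _; rewrite tnthS.
    by congr (_ + _); apply: eq_bigr => i _; rewrite tnthS.
  under eq_integral => y _ do rewrite E EFinM.
  rewrite ge0_integralZl//.
  - by rewrite ih// -EFinM -/V -/S addrAC.
  - by apply/measurable_EFinP; exact: measurable_gauss_prod.
  - by move=> y _; rewrite lee_fin gauss_prod_ge0.
  - by rewrite lee_fin gauss_ge0.
by rewrite gauss_convolution ?ltr_wpDr//; congr (gauss _ _)%:E; ring.
Qed.

End gaussian.

(** * The covariance matrix and the normal density *)

(** Both sides are the determinant of the block matrix with rows [1, u] and
    [v, 1], factored in the two possible orders. *)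
Lemma det_1subM (F : comPzRingType) d (u : 'cV[F]_d) (v : 'rV[F]_d) :
  \det (1%:M - u *m v) = 1 - (v *m u) 0 0.
Proof.
have e1 : block_mx 1%:M u v 1%:M =
    block_mx 1%:M 0 v 1%:M *m block_mx 1%:M u 0 (1%:M - v *m u).
  by rewrite mulmx_block ?(mul1mx, mul0mx, mulmx1, mulmx0, addr0) subrKC.
have e2 : block_mx 1%:M u v 1%:M =
    block_mx 1%:M u 0 1%:M *m block_mx (1%:M - u *m v) 0 v 1%:M.
  by rewrite mulmx_block ?(mul1mx, mul0mx, mulmx1, mulmx0, add0r) subrK.
have := congr1 determinant e1; rewrite e2 !det_mulmx !det_lblock !det_ublock !det1.
by rewrite !mul1r !mulr1 det_mx11 !mxE eqxx.
Qed.

Section multinomial_covariance.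
Context {R : realType} (d : nat) (p : d.-tuple R).
Hypothesis p_gt0 : forall i, 0 < tnth p i.
Let q := 1 - \sum_(i < d) tnth p i.
Hypothesis q_gt0 : 0 < q.

Let r := row_of p.
Let one : 'rV[R]_d := const_mx 1.
Let rV : 'rV[R]_d := map_mx GRing.inv r.

Let diag_rrV : diag_mx r *m diag_mx rV = 1%:M.
Proof.
rewrite mulmx_diag; apply/matrixP => i j; rewrite !mxE mulfV//.
by rewrite gt_eqF.
Qed.

Let diag_r1 : diag_mx r *m one^T = r^T.
Proof.
by apply/matrixP => i j; rewrite mul_diag_mx !mxE mulr1.
Qed.

Let r_diag_rV : r *m diag_mx rV = one.
Proof.
apply/matrixP => i j; rewrite mul_mx_diag !mxE mulfV//.
by rewrite gt_eqF.
Qed.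

Let r_one : r *m one^T = (1 - q)%:M.
Proof.
apply/matrixP => i j; rewrite !ord1 !mxE eqxx /q subKr.
by apply: eq_bigr => k _; rewrite !mxE mulr1.
Qed.

Lemma det_multinomial_cov : \det (multinomial_cov p) = q * \prod_(i < d) tnth p i.
Proof.
rewrite /multinomial_cov -/r.
have -> : diag_mx r - r^T *m r = diag_mx r *m (1%:M - one^T *m r).
  by rewrite mulmxBr mulmx1 mulmxA diag_r1.
rewrite det_mulmx det_1subM r_one !mxE eqxx subKr det_diag mulrC; congr (_ * _).
by apply: eq_bigr => i _; rewrite mxE.
Qed.

(** The covariance is a diagonal matrix minus a matrix of rank one, so its
    inverse is a diagonal matrix plus a matrix of rank one. *)
Lemma invmx_multinomial_cov (n : R) : n != 0 ->
  invmx (n *: multinomial_cov p) =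
  n^-1 *: (diag_mx rV + q^-1 *: (one^T *m one)).
Proof.
move=> n0.
suff H : (n *: multinomial_cov p) *m
    (n^-1 *: (diag_mx rV + q^-1 *: (one^T *m one))) = 1%:M.
  have [u _] := mulmx1_unit H.
  by rewrite -[RHS](mulKmx u) H mulmx1.
rewrite -scalemxAl -scalemxAr scalerA mulfV// scale1r /multinomial_cov -/r.
rewrite mulmxBl !mulmxDr diag_rrV -!scalemxAr mulmxA diag_r1 -!mulmxA r_diag_rV.
rewrite (mulmxA r) r_one mul_scalar_mx -!scalemxAr scalerA.
rewrite -addrA -[RHS]addr0; congr (_ + _).
rewrite opprD addrCA -scalerBl -scaleN1r -scalerDl.
rewrite (_ : _ + _ = 0) ?scale0r//.
by field; rewrite gt_eqF.
Qed.

Lemma multinomial_cov_quad (n : R) (y : 'rV[R]_d) : 0 < n ->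
  (y *m invmx (n *: multinomial_cov p) *m y^T) 0 0 =
  \sum_(i < d) y 0 i ^+ 2 / (n * tnth p i) + (\sum_(i < d) y 0 i) ^+ 2 / (n * q).
Proof.
move=> n0; rewrite invmx_multinomial_cov ?gt_eqF//.
rewrite -scalemxAr -scalemxAl mulmxDr mulmxDl mxE mxE -scalemxAr -scalemxAl [X in _ * (_ + X)]mxE.
have -> : (y *m diag_mx rV *m y^T) 0 0 = \sum_(i < d) y 0 i ^+ 2 / tnth p i.
  rewrite mxE; apply: eq_bigr => i _.
  by rewrite mul_mx_diag !mxE mulrAC -expr2.
have -> : (y *m (one^T *m one) *m y^T) 0 0 = (\sum_(i < d) y 0 i) ^+ 2.
  have yo : y *m one^T = (\sum_(i < d) y 0 i)%:M.
    apply/matrixP => i j; rewrite !ord1 !mxE eqxx mulr1n.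
    by apply: eq_bigr => k _; rewrite !mxE mulr1.
  have oy : one *m y^T = (\sum_(i < d) y 0 i)%:M.
    apply/matrixP => i j; rewrite !ord1 !mxE eqxx mulr1n.
    by apply: eq_bigr => k _; rewrite !mxE mul1r.
  by rewrite mulmxA yo -mulmxA oy mul_scalar_mx !mxE eqxx mulr1n expr2.
rewrite mulrDr mulr_sumr; congr (_ + _).
  by apply: eq_bigr => i _; field; rewrite ?gt_eqF.
by move: (q) q_gt0 => b b0; field; rewrite ?gt_eqF.
Qed.

Lemma sqrtr_prod (I : Type) (s : seq I) (a : I -> R) : (forall i, 0 <= a i) ->
  Num.sqrt (\prod_(i <- s) a i) = \prod_(i <- s) Num.sqrt (a i).
Proof.
move=> a0; elim: s => [|i s ih]; first by rewrite !big_nil sqrtr1.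
by rewrite !big_cons sqrtrM ?ih.
Qed.

(** The multinomial-type normal density is the conditional density of
    independent normal variables of variances [n p_1, ..., n p_{d+1}] given
    their sum, just as the multinomial law is that of Poisson variables. *)
Lemma mvnormal_pdf_gauss_prod (n : R) (x : d.-tuple R) : 0 < n ->
  mvnormal_pdf (n *: row_of p) (n *: multinomial_cov p) x =
  gauss_prod (fun i => n * tnth p i) (fun i => n * tnth p i) (n * q)
    (- \sum_(i < d) n * tnth p i) x / gauss n 0.
Proof.
move=> n0; rewrite /mvnormal_pdf multinomial_cov_quad// detZ det_multinomial_cov.
have nq0 : 0 < n * q by rewrite mulr_gt0.
have np0 i : 0 < n * tnth p i by rewrite mulr_gt0.
have gauss0 : (gauss n 0)^-1 = Num.sqrt (2 * pi * n).
  by rewrite /gauss expr0n/= oppr0 mul0r expR0 mulr1 invrK.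
rewrite gauss0 /gauss_prod /gauss big_split/= -expR_sum.
rewrite [X in _ = X * _]mulrACA -expRD [RHS]mulrAC; congr (_ * expR _).
  rewrite prodfV -sqrtr_prod => [|i]; last by rewrite !mulr_ge0 ?pi_ge0 ?ltW.
  rewrite -invfM -sqrtrM; last first.
    by apply: prodr_ge0 => i _; rewrite mulr_ge0 ?ltW// mulr_gt0 ?pi_gt0.
  rewrite -[X in _ = _ * X]invrK -invfM -[in RHS]sqrtrV ?mulr_ge0 ?pi_ge0 ?ltW//.
  rewrite -sqrtrM; last first.
    rewrite mulr_ge0 ?mulr_ge0 ?pi_ge0 ?ltW//.
    by apply: prodr_gt0 => i _; rewrite mulr_gt0// mulr_gt0 ?pi_gt0.
  congr (Num.sqrt _)^-1; rewrite !big_split/= !prodr_const !card_ord exprMn.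
  move: (\prod_(i < d) _) (pi) (pi_gt0 R) (q) => P a a0 b.
  by field; rewrite !gt_eqF.
rewrite mulNr mulrDl opprD mulr_suml -sumrN; congr (_ + _).
  by apply: eq_bigr => i _; rewrite !mxE; field; rewrite ?gt_eqF.
rewrite (_ : \sum_i (row_of x - n *: row_of p) 0 i =
    - (\sum_(i < d) n * tnth p i) + \sum_(i < d) tnth x i); last first.
  by rewrite [RHS]addrC -sumrB; apply: eq_bigr => i _; rewrite !mxE.
by move: (q) q_gt0 => b b0; field; rewrite ?gt_eqF.
Qed.

Lemma integral_mvnormal_pdf (n : R) : 0 < n ->
  (\int[lebesgue_tuple R d]_x
    (mvnormal_pdf (n *: row_of p) (n *: multinomial_cov p) x)%:E = 1)%E.
Proof.
move=> n0; have nq0 : 0 < n * q by rewrite mulr_gt0.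
under eq_integral => x _ do rewrite mvnormal_pdf_gauss_prod// EFinM muleC.
have g0 : 0 < gauss n 0 by exact: gauss_gt0.
rewrite ge0_integralZl//; last 3 first.
- by apply/measurable_EFinP; exact: measurable_gauss_prod.
- by move=> x _; rewrite lee_fin gauss_prod_ge0.
- by rewrite lee_fin invr_ge0 ltW.
rewrite integral_gauss_prod//; last by move=> i; rewrite mulr_gt0.
rewrite -EFinM; congr EFin; rewrite addNr (_ : n * q + _ = n); first by rewrite mulVf ?gt_eqF.
by rewrite -mulr_sumr -mulrDr subrK mulr1.
Qed.

Lemma measurable_mvnormal_pdf (n : R) : 0 < n ->
  measurable_fun [set: d.-tuple R]
    (mvnormal_pdf (n *: row_of p) (n *: multinomial_cov p)).
Proof.
move=> n0; rewrite (funext (fun x => mvnormal_pdf_gauss_prod x n0)).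
by apply: measurable_funM => //; exact: measurable_gauss_prod.
Qed.

End multinomial_covariance.

(** * Total variation of two densities *)

Section total_variation.
Context {R : realType} {disp : measure_display} {T : measurableType disp}.
Variable m : {measure set T -> \bar R}.
Local Open Scope ereal_scope.

Definition excess (f g : R) : R := Num.max (f - g)%R 0%R.

Lemma excess_ge0 f g : (0 <= excess f g)%R.
Proof. by rewrite /excess le_max lexx orbT. Qed.

Lemma normrB_excess (f g : R) : (`|f - g| + f = 2 * excess f g + g)%R.
Proof.
rewrite /excess; case: (leP (f - g)%R 0%R) => h.
  by rewrite ler0_norm//; ring.
by rewrite gtr0_norm//; ring.
Qed.

Lemma measurable_excess (f g : T -> R) : measurable_fun setT f ->
  measurable_fun setT g -> measurable_fun setT (fun x => excess (f x) (g x)).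
Proof.
by move=> mf mg; apply: measurable_maxr => //; exact: measurable_funB.
Qed.

(** Two probability densities have the same mass, so each point where [f]
    exceeds [g] is compensated where [g] exceeds [f]. *)
Lemma tv_norm_le_excess (mu nu : set T -> \bar R) (f g : T -> R) :
  measurable_fun setT f -> measurable_fun setT g ->
  (forall x, 0 <= f x)%R -> (forall x, 0 <= g x)%R ->
  (forall A, measurable A -> mu A = \int[m]_(x in A) (f x)%:E) ->
  (forall A, measurable A -> nu A = \int[m]_(x in A) (g x)%:E) ->
  \int[m]_x (f x)%:E = 1 -> \int[m]_x (g x)%:E = 1 ->
  tv_norm mu nu <= 2%:E * \int[m]_x (excess (f x) (g x))%:E.
Proof.
move=> mf mg f0 g0 muE nuE f1 g1.
have If : m.-integrable setT (EFin \o f).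
  apply/integrableP; split; first exact/measurable_EFinP.
  by under eq_integral do rewrite /= ger0_norm//; rewrite f1 ltry.
have Ig : m.-integrable setT (EFin \o g).
  apply/integrableP; split; first exact/measurable_EFinP.
  by under eq_integral do rewrite /= ger0_norm//; rewrite g1 ltry.
have mfg : measurable_fun setT (fun x => f x - g x)%R by exact: measurable_funB.
have mabs : measurable_fun setT (fun x => (`|f x - g x|)%:E).
  by apply/measurable_EFinP; exact: measurableT_comp.
have mexc : measurable_fun setT (fun x => (excess (f x) (g x))%:E).
  by apply/measurable_EFinP; exact: measurable_excess.
have abs_excess : \int[m]_x (`|f x - g x|)%:E =
    2%:E * \int[m]_x (excess (f x) (g x))%:E.
  have : \int[m]_x (`|f x - g x|)%:E + 1 =
      2%:E * \int[m]_x (excess (f x) (g x))%:E + 1.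
    rewrite -{1}f1 -g1 -ge0_integralZl//; last first.
      by move=> x _; rewrite lee_fin excess_ge0.
    have fE : measurable_fun setT (fun x => (f x)%:E) by exact/measurable_EFinP.
    have gE : measurable_fun setT (fun x => (g x)%:E) by exact/measurable_EFinP.
    have f0E x : setT x -> 0 <= (f x)%:E by rewrite lee_fin.
    have g0E x : setT x -> 0 <= (g x)%:E by rewrite lee_fin.
    have e0E x : setT x -> 0 <= 2%:E * (excess (f x) (g x))%:E.
      by move=> _; rewrite mule_ge0// lee_fin excess_ge0.
    rewrite -ge0_integralD// -ge0_integralD//; last exact: measurable_funeM.
    by apply: eq_integral => x _; rewrite -EFinM -!EFinD normrB_excess.
  by move=> /(congr1 (fun y => y - 1)); rewrite !addeK.
rewrite -abs_excess; apply: ge_ereal_sup => _ [F [mF tF UF] <-].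
rewrite -UF ge0_integral_bigcup//; last by rewrite UF.
apply: lee_nneseries => [k _ _|k _].
  exact: abse_ge0.
rewrite muE// nuE// -integralB_EFin//; last 2 first.
- exact: integrableS If.
- exact: integrableS Ig.
apply: le_trans (le_abse_integral _ _ _) _ => //.
by apply/measurable_EFinP; exact: measurable_funS mfg.
Qed.

End total_variation.

(** * Unit cells *)

Section cells.
Context {R : realType} (d : nat).
Local Open Scope ereal_scope.
Implicit Types (c x : d.-tuple R) (A : set (d.-tuple R)).
Local Notation leb := (lebesgue_tuple R d).

Definition cell c : set (d.-tuple R) :=
  [set x | forall i, (- (1 / 2) < tnth x i - tnth c i < 1 / 2)%R].

Lemma tuple_box_bigcap (A : 'I_d -> set R) :
  [set x : d.-tuple R | forall i, A i (tnth x i)] =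
  \big[setI/setT]_(i < d) ((fun x : d.-tuple R => tnth x i) @^-1` A i).
Proof.
apply/seteqP; split => [x /= xA|x].
  by rewrite -bigcap_seq => i _ /=; exact: xA.
by rewrite -bigcap_seq => + i => /(_ i); apply; rewrite /= mem_index_enum.
Qed.

Lemma measurable_tuple_box (A : 'I_d -> set R) : (forall i, measurable (A i)) ->
  measurable [set x : d.-tuple R | forall i, A i (tnth x i)].
Proof.
move=> mA; rewrite tuple_box_bigcap.
apply: bigsetI_measurable => i _; rewrite -[X in measurable X]setTI.
exact: measurable_tnth.
Qed.

Lemma measurable_set1_tuple c : measurable [set c].
Proof.
rewrite (_ : [set c] = [set x | forall i, [set tnth c i] (tnth x i)]).
  exact: (@measurable_tuple_box (fun i => [set tnth c i])).
by apply/seteqP; split => [x -> //|x /= h]; apply/eq_from_tnth.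
Qed.

Lemma cell_box c : cell c = [set x | forall i,
  [set` `]tnth c i - 1 / 2, tnth c i + 1 / 2[%R] (tnth x i)].
Proof.
apply/seteqP; split => x h i; have := h i; rewrite /= in_itv/=;
  move=> /andP[h1 h2]; apply/andP; split; lra.
Qed.

Lemma measurable_cell c : measurable (cell c).
Proof.
rewrite cell_box.
by apply: (@measurable_tuple_box (fun i => [set` `]_, _[%R])) => i; exact: measurable_itv.
Qed.

Lemma cell_add c v : cell c (tuple_add v c) <-> cube v.
Proof.
by split => h i; have := h i; rewrite tnth_mktuple addrK.
Qed.

Lemma cube_box : @cube R d = [set x | forall i,
  [set` `](- (1 / 2)), (1 / 2)[%R] (tnth x i)].
Proof. by apply/seteqP; split => x h i; have := h i; rewrite /= in_itv. Qed.

Lemma measurable_cube : measurable (@cube R d).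
Proof.
rewrite cube_box.
by apply: (@measurable_tuple_box (fun i => [set` `]_, _[%R])) => i; exact: measurable_itv.
Qed.

Lemma lebesgue_cube : leb (@cube R d) = 1.
Proof.
rewrite cube_box (@lebesgue_tuple_box _ _ (fun i => [set` `]_, _[%R]))// big1// => i _.
rewrite lebesgue_measure_itv/= lte_fin ifT; last by lra.
by rewrite -EFinB; congr EFin; lra.
Qed.

Lemma ge0_integral_cell c (h : d.-tuple R -> \bar R) :
  measurable_fun setT h -> (forall x, 0 <= h x) ->
  \int[leb]_(x in cell c) h x = \int[leb]_(v in @cube R d) h (tuple_add v c).
Proof.
move=> mh h0; rewrite integral_mkcond [RHS]integral_mkcond.
rewrite -(ge0_integral_tuple_add c); last 2 first.
- by apply/(measurable_restrictT _ _).1 => //; [exact: measurable_cell|exact: measurable_funTS].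
- by move=> x; rewrite patchE; case: ifP.
apply: eq_integral => v _; rewrite !patchE; congr (if _ then _ else _).
by apply/idP/idP; rewrite !inE => /cell_add.
Qed.

Lemma lebesgue_cell_translate c A : measurable A ->
  leb ([set v | A (tuple_add v c)] `&` @cube R d) = leb (A `&` cell c).
Proof.
move=> mA; have mi : measurable_fun setT (fun x => (\1_A x)%:E : \bar R).
  by apply/measurable_EFinP.
rewrite -[RHS]integral_indic//; last exact: measurable_cell.
rewrite ge0_integral_cell//.
pose B := [set v | A (tuple_add v c)].
have mB : measurable B.
  by rewrite -[X in measurable X]setTI; exact: (measurable_tuple_add c measurableT mA).
by rewrite -(integral_indic leb measurable_cube mB).
Qed.

End cells.

Section cube_variance.
Context {R : realType}.
Local Open Scope ereal_scope.
Local Notation mu := (@lebesgue_measure R).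

Lemma integral_itv_sqr (s b : R) :
  \int[mu]_(x in `](- (1 / 2))%R, (1 / 2)%R[) ((s + x) ^+ 2 + b)%:E =
  (s ^+ 2 + 1 / 12 + b)%:E.
Proof.
have cf : continuous (fun x : R => (s + x) ^+ 2 + b)%R.
  move=> x; apply: cvgD; last exact: cvg_cst.
  apply: (@continuous_comp _ _ _ (fun x => s + x)%R (fun x => x ^+ 2)%R).
    by apply: cvgD; [exact: cvg_cst|exact: cvg_id].
  exact: exprn_continuous.
have dF x : is_derive x (1%R : R) (fun x : R => (s + x) ^+ 3 / 3 + b * x)%R
    ((s + x) ^+ 2 + b)%R.
  apply: is_derive_eq; rewrite /GRing.scale/= ?(mulr0, add0r, addr0, mulr1).
  rewrite /=; set y := (s + x)%R; rewrite !expr2.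
  by field.
have cF : continuous (fun x : R => (s + x) ^+ 3 / 3 + b * x)%R.
  by move=> x; apply/differentiable_continuous/derivable1_diffP; have [] := dF x.
rewrite -(@integral_itv_bndoo _ _ _ _ true false); last first.
  apply/measurable_EFinP; apply: measurable_funTS.
  exact: continuous_measurable_fun.
rewrite (@continuous_FTC2 _ _ (fun x : R => (s + x) ^+ 3 / 3 + b * x)%R).
- by rewrite -EFinB; congr EFin; field.
- by lra.
- exact: continuous_subspaceT.
- split.
  + by move=> x _; have [] := dF x.
  + by apply: cvg_at_right_filter; exact: cF.
  + by apply: cvg_at_left_filter; exact: cF.
- by move=> x _; rewrite derive1E; have [] := dF x.
Qed.

(** The coordinates of a uniform point of the cube are uncorrelated, of
    variance [1 / 12]. The linear growth in [d] is essential: the pointwise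
    bound on the square is of order [d ^ 2]. *)
Lemma integral_cube_sum_sqr d (s : R) :
  \int[lebesgue_tuple R d]_(v in @cube R d) ((s + \sum_(i < d) tnth v i) ^+ 2)%:E
  = (s ^+ 2 + d%:R / 12)%:E.
Proof.
have mf e (t : R) : measurable_fun [set: e.-tuple R]
    (fun v : e.-tuple R => ((t + \sum_(i < e) tnth v i) ^+ 2)%:E).
  apply/measurable_EFinP; apply: measurable_funX; apply: measurable_funD => //.
  by apply: measurable_sum => i; exact: measurable_tnth.
elim: d s => [|d ih] s; rewrite integral_mkcond.
  rewrite integral_lebesgue_tuple0 patchE ifT; last by rewrite inE => -[].
  by rewrite big_ord0 addr0 mul0r addr0.
rewrite integral_lebesgue_tupleS; last 2 first.
- apply/(measurable_restrictT _ _).1 => //; first exact: measurable_cube.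
  by apply: measurable_funTS; exact: mf.
- by move=> v; rewrite patchE; case: ifP => // _; rewrite lee_fin sqr_ge0.
have -> : (s ^+ 2 + d.+1%:R / 12 = s ^+ 2 + 1 / 12 + d%:R / 12 :> R)%R.
  by rewrite -(natr1 d); ring.
rewrite -integral_itv_sqr [RHS]integral_mkcond; apply: eq_integral => x _.
rewrite patchE; case: ifPn => [|] xI.
  rewrite -ih [RHS]integral_mkcond; apply: eq_integral => y _; rewrite !patchE.
  rewrite big_ord_recl addrA.
  have -> : ([tuple of x :: y] \in @cube R d.+1) = (y \in @cube R d).
    apply/idP/idP; rewrite !inE => h i.
      by have := h (lift ord0 i); rewrite tnthS.
    case: (unliftP ord0 i) => [j|] ->; first by rewrite tnthS.
    by move: xI; rewrite inE/= in_itv.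
  case: ifP => // _; congr ((_ + _) ^+ 2)%:E.
  by apply: eq_bigr => i _; rewrite tnthS.
apply: integral0_eq => y _; rewrite patchE ifF//; apply/negbTE; apply: contra xI.
by rewrite !inE => /(_ ord0); rewrite /= in_itv.
Qed.

End cube_variance.

(** * Lattice laws spread over cells *)

Section compositions.
Variables (d n : nat).
Implicit Types f : {ffun 'I_d.+1 -> 'I_n.+1}.

(** The entries of a vector of sum [n] are at most [n]. Bounding their type by
    [n] makes the family finite, and a duplicate-free sequence. *)
Definition compositions : seq {ffun 'I_d.+1 -> 'I_n.+1} :=
  enum [pred f : {ffun 'I_d.+1 -> 'I_n.+1} | (\sum_i f i == n)%N].

Definition head_vec f : d.-tuple nat := [tuple (f (widen_ord (leqnSn d) i) : nat) | i < d].

Lemma mem_compositions f : (f \in compositions) = (\sum_i f i == n)%N.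
Proof. by rewrite mem_enum inE. Qed.

Lemma compositions_uniq : uniq compositions.
Proof. exact: enum_uniq. Qed.

Lemma sum_head_vec f : (\sum_i f i = \sum_(i < d) tnth (head_vec f) i + f ord_max)%N.
Proof.
by rewrite big_ord_recr/=; congr addn; apply: eq_bigr => i _; rewrite tnth_mktuple.
Qed.

Lemma kbar_head_vec f i : f \in compositions -> tnth (kbar n (head_vec f)) i = f i.
Proof.
rewrite mem_compositions sum_head_vec => /eqP fn.
rewrite (tnth_nth 0%N)/= nth_rcons size_map size_enum_ord.
have [id|di] := ltnP i d.
  rewrite (_ : nth _ _ _ = tnth (head_vec f) (Ordinal id)); last first.
    by rewrite (tnth_nth 0%N).
  by rewrite tnth_mktuple; congr (nat_of_ord (f _)); apply/val_inj.
have -> : i = ord_max by apply/val_inj/eqP; rewrite eqn_leq di -ltnS ltn_ord.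
by rewrite eqxx -[X in (X - _)%N]fn addKn.
Qed.

Lemma head_vec_le f : f \in compositions -> (\sum_(i < d) tnth (head_vec f) i <= n)%N.
Proof. by rewrite mem_compositions sum_head_vec => /eqP fn; rewrite -[leqRHS]fn leq_addr. Qed.

Lemma head_vec_inj : {in compositions &, injective head_vec}.
Proof.
move=> f g fn gn fg; apply/ffunP => i; apply/val_inj => /=.
by rewrite -(kbar_head_vec i fn) -(kbar_head_vec i gn) fg.
Qed.

Lemma head_vec_onto (k : d.-tuple nat) : (\sum_(i < d) tnth k i <= n)%N ->
  exists2 f, f \in compositions & head_vec f = k.
Proof.
move=> kn.
have kb i : (tnth (kbar n k) i < n.+1)%N.
  rewrite (tnth_nth 0%N)/= nth_rcons size_tuple ltnS.
  case: ltnP => id; last by case: eqP => // _; exact: leq_subr.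
  rewrite -(tnth_nth 0%N k (Ordinal id)) (leq_trans _ kn)//.
  by rewrite (bigD1 (Ordinal id))//= leq_addr.
pose f := [ffun i => Ordinal (kb i)].
have fk : head_vec f = k.
  apply/eq_from_tnth => i; rewrite tnth_mktuple ffunE/=.
  by rewrite (tnth_nth 0%N)/= nth_rcons size_tuple ltn_ord -tnth_nth.
exists f => //; rewrite mem_compositions sum_head_vec fk ffunE/=.
by rewrite (tnth_nth 0%N)/= nth_rcons size_tuple ltnn eqxx subnKC.
Qed.

End compositions.

Section law_of_jittered_vector.
Context {R : realType} (d n : nat).
Local Open Scope ereal_scope.
Local Notation leb := (lebesgue_tuple R d).

Definition point (f : {ffun 'I_d.+1 -> 'I_n.+1}) : d.-tuple R := nat_vec R (head_vec f).

Lemma nat_vec_inj : injective (@nat_vec R d).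
Proof.
move=> k l /(congr1 (fun x => tnth x)) kl; apply/eq_from_tnth => i.
have := congr1 (fun h => h i) kl; rewrite !tnth_mktuple => /eqP.
by rewrite eqr_nat => /eqP.
Qed.

Lemma point_inj : {in compositions d n &, injective point}.
Proof. by move=> f g fn gn /nat_vec_inj; exact: head_vec_inj. Qed.

(** Distinct lattice points are at distance at least [1] in some coordinate. *)
Lemma trivIset_cell : trivIset [set` compositions d n] (fun f => cell (point f)).
Proof.
move=> f g fn gn [x [fx gx]]; apply: point_inj => //.
apply/eq_from_tnth => i; have := fx i; have := gx i.
rewrite !tnth_mktuple; move: (f _ : nat) (g _ : nat) => a b /andP[h1 h2] /andP[h3 h4].
have [ab|ba|-> //] := ltngtP a b.
- have : (a.+1%:R <= b%:R :> R)%R by rewrite ler_nat.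
  by rewrite -(natr1 a); lra.
- have : (b.+1%:R <= a%:R :> R)%R by rewrite ler_nat.
  by rewrite -(natr1 b); lra.
Qed.

Variables (S : set (d.-tuple nat)) (w : d.-tuple nat -> R).
Hypothesis w_ge0 : forall k, (0 <= w k)%R.
Hypothesis Ssub : S `<=` @multinomial_support d n.
Hypothesis w_supp : forall k, multinomial_support n k -> ~ S k -> w k = 0%R.

Lemma discrete_law_point f : f \in compositions d n ->
  discrete_law S w [set point f] = (w (head_vec f))%:E.
Proof.
move=> fn; rewrite /discrete_law.
have [Sf|Sf] := pselect (S (head_vec f)).
  rewrite (_ : _ `&` _ = [set head_vec f]) ?esum_set1 ?lee_fin//.
  apply/seteqP; split => [k /= [_ /nat_vec_inj]//|k /= ->]; by split.
rewrite esum1 ?w_supp//; first exact: head_vec_le.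
by move=> k /= [Sk /nat_vec_inj kf]; case: Sf; rewrite -kf.
Qed.

Lemma discrete_law_off : discrete_law S w
  (~` \bigcup_(f in [set` compositions d n]) [set point f]) = 0.
Proof.
rewrite /discrete_law esum1// => k [/Ssub Sk] /=.
have [f fn <-] := head_vec_onto Sk.
by case; exists f.
Qed.

Context {disp : measure_display} {Omega : measurableType disp}.
Variables (P : probability Omega R) (K U : {RV P >-> d.-tuple R}).
Hypothesis lawK : has_law P K (discrete_law S w).
Hypothesis lawU : has_law P U (@uniform_law R d).
Hypothesis indep : forall A B, measurable A -> measurable B ->
  P (K @^-1` A `&` U @^-1` B) = P (K @^-1` A) * P (U @^-1` B).

Let measurable_point : measurable (\bigcup_(f in [set` compositions d n]) [set point f]).
Proof.
apply: fin_bigcup_measurable => //.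
by move=> f _; exact: measurable_set1_tuple.
Qed.

Let measurable_preim (Z : {RV P >-> d.-tuple R}) A : measurable A -> measurable (Z @^-1` A).
Proof. by move=> mA; rewrite -[X in measurable X]setTI; exact: measurable_funPT. Qed.

(** [K] takes its values in a finite set almost surely. *)
Lemma prob_split_point B : measurable B ->
  P B = \sum_(f <- compositions d n) P (B `&` K @^-1` [set point f]).
Proof.
move=> mB.
set E := \bigcup_(f in [set` compositions d n]) [set point f].
rewrite (measureDI P mB (measurable_preim K measurable_point)).
rewrite (@subset_measure0 _ _ _ P _ (K @^-1` (~` E))); last 4 first.
- exact: measurableD (measurable_preim K measurable_point).
- exact/measurable_preim/measurableC.
- by move=> x [].
- by have := lawK (measurableC measurable_point); rewrite discrete_law_off.
rewrite add0e /E preimage_bigcup setI_bigcupr measure_fin_bigcup//.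
- by rewrite -fsbig_seq ?compositions_uniq.
- move=> f g fn gn [x [[_ /= xf] [_ /= xg]]]; apply: point_inj => //.
  by rewrite -xf -xg.
- move=> f _; apply: measurableI => //; apply: measurable_preim.
  exact: measurable_set1_tuple.
Qed.

Lemma prob_point f : f \in compositions d n ->
  P (K @^-1` [set point f]) = (w (head_vec f))%:E.
Proof.
by move=> fn; rewrite -discrete_law_point// -(lawK (measurable_set1_tuple _)).
Qed.

(** That the weights sum to [1] is read off from the existence of a random
    variable with this law. *)
Lemma sum_weights : (\sum_(f <- compositions d n) w (head_vec f) = 1)%R.
Proof.
apply: EFin_inj; rewrite -sumEFin -(@probability_setT _ _ _ P).
rewrite (prob_split_point measurableT) big_seq [RHS]big_seq.
by apply: eq_bigr => f fn; rewrite setTI prob_point.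
Qed.

Lemma prob_jittered A : measurable A ->
  P [set o | A (tuple_add (K o) (U o))] =
  \sum_(f <- compositions d n) (w (head_vec f))%:E * leb (A `&` cell (point f)).
Proof.
move=> mA.
have addC (x y : d.-tuple R) : tuple_add x y = tuple_add y x.
  by apply/eq_from_tnth => i; rewrite !tnth_mktuple addrC.
have mX : measurable [set o | A (tuple_add (K o) (U o))].
  rewrite -[X in measurable X]setTI.
  have : measurable_fun setT (fun o => tuple_add (K o) (U o)).
    apply/measurable_fun_tnthP => i.
    rewrite (_ : _ \o _ = (fun o => tnth (K o) i + tnth (U o) i)%R); last first.
      by apply/funext => o /=; rewrite tnth_mktuple.
    by apply: measurable_funD; apply: (measurableT_comp (measurable_tnth i)).
  by move=> /(_ measurableT _ mA).
rewrite (prob_split_point mX) big_seq [RHS]big_seq; apply: eq_bigr => f fn.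
pose B := [set v | A (tuple_add v (point f))].
have mB : measurable B.
  by rewrite -[X in measurable X]setTI; exact: (measurable_tuple_add _ measurableT mA).
rewrite (_ : _ `&` _ = K @^-1` [set point f] `&` U @^-1` B); last first.
  by apply/seteqP; split => o /= [h1 h2]; split => //; move: h1 h2;
    rewrite /B/= addC; [move=> + <-|move=> ->].
rewrite indep//; last exact: measurable_set1_tuple.
rewrite prob_point//; congr (_ * _).
by rewrite -lebesgue_cell_translate//; exact: (lawU mB).
Qed.

End law_of_jittered_vector.

(** * Relative entropy of the multinomial law and the normal density *)

Section coordinate_bounds.
Context {R : realType}.
Implicit Types (m w v x : R) (k n : nat).

Lemma ln_gauss v x : 0 < v ->
  ln (gauss v x) = - (ln (2 * pi) / 2) - ln v / 2 - x ^+ 2 / (2 * v).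
Proof.
move=> v0; have p0 := pi_gt0 R.
have a0 : 0 < 2 * pi * v by rewrite !mulr_gt0.
have s0 : 0 < Num.sqrt (2 * pi * v) by rewrite sqrtr_gt0.
have -> : ln (gauss v x) = - ln (Num.sqrt (2 * pi * v)) - x ^+ 2 / (2 * v).
  rewrite /gauss [LHS]lnM ?posrE ?invr_gt0 ?expR_gt0//.
  by rewrite expRK lnV ?posrE// mulNr.
congr (_ - _).
have : ln (2 * pi * v) = 2 * ln (Num.sqrt (2 * pi * v)).
  by rewrite -[in LHS](sqr_sqrtr (ltW a0)) lnXn// [RHS]mulr_natl.
by rewrite lnM ?posrE ?mulr_gt0//; lra.
Qed.

(** Stirling's bound for [k], with [y ln y] replaced by its cubic Taylor
    polynomial at [m]. *)
Lemma ln_fact_lb m k (y := k%:R + 1 / 2) : 0 < m ->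
  - m + ln (2 * pi) / 2 + ln m / 2 + (y - m) ^+ 2 / (2 * m)
    - (y - m) ^+ 3 / (6 * m ^+ 2) - 1 / (4 * k.+1%:R)
  <= ln k`!%:R - k%:R * ln m.
Proof.
move=> m0; have y0 : 0 < y := half_shift_gt0 k.
have ym : 0 < y / m by rewrite divr_gt0.
have := xlnx_taylor3_ge ym; rewrite -(ler_pM2l m0) ln_div ?posrE//.
have -> : m * ((y / m - 1) ^+ 2 / 2 - (y / m - 1) ^+ 3 / 6) =
    (y - m) ^+ 2 / (2 * m) - (y - m) ^+ 3 / (6 * m ^+ 2).
  by field; rewrite gt_eqF.
have -> : m * (y / m * (ln y - ln m) - y / m + 1) = y * (ln y - ln m) - y + m.
  by field; rewrite gt_eqF.
have := stirling_rem_lb (R := R) k; rewrite /stirling_rem /half_shift -/y.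
have ek : k%:R = y - 1 / 2 by rewrite /y addrK.
rewrite ek; move: (1 / (4 * _)) (_ / (2 * m)) (_ / (6 * m ^+ 2)) => a b c.
by rewrite !mulrBl !mulrBr; lra.
Qed.

Lemma ln_fact_ub n : (0 < n)%N ->
  ln n`!%:R - n%:R * ln n%:R <= 1 / (4 * n%:R) - n%:R + ln (2 * pi) / 2 + ln n%:R / 2 :> R.
Proof.
move=> n0; have N0 : 0 < n%:R :> R by rewrite ltr0n.
have := stirling_rem_ub (R := R) n; rewrite /stirling_rem /half_shift.
have -> : n%:R + 1 / 2 = n%:R * (1 + 1 / (2 * n%:R)) :> R by field; rewrite gt_eqF.
have u0 : 0 < 1 / (2 * n%:R) :> R by rewrite divr_gt0// mulr_gt0.
have p1 : 0 < 1 + 1 / (2 * n%:R) :> R by rewrite addr_gt0.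
rewrite [ln (n%:R * _)]lnM ?posrE//.
have l1 : ln (1 + 1 / (2 * n%:R)) <= 1 / (2 * n%:R) :> R.
  by apply: le_ln1Dx; exact: lt_trans (ltrN10 _) u0.
have : n%:R * (1 + 1 / (2 * n%:R)) * ln (1 + 1 / (2 * n%:R)) <=
    n%:R * (1 + 1 / (2 * n%:R)) * (1 / (2 * n%:R)) :> R.
  by rewrite ler_pM2l// mulr_gt0// addr_gt0.
have -> : n%:R * (1 + 1 / (2 * n%:R)) * (1 / (2 * n%:R)) = 1 / 2 + 1 / (4 * n%:R) :> R.
  by field; rewrite gt_eqF.
have -> : n%:R * (1 + 1 / (2 * n%:R)) = n%:R + 1 / 2 :> R by field; rewrite gt_eqF.
by rewrite mulrDr; move: (1 / (4 * n%:R)) (ln (1 + _)) => a b; lra.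
Qed.

(** An upper bound on [1 / (k + 1)] that is polynomial in [k], so that its
    mean only involves the first two moments. *)
Lemma inv_succ_le m k : 0 < m ->
  1 / k.+1%:R <= 2 / m + 4 * (k.+1%:R - m) ^+ 2 / m ^+ 2.
Proof.
move=> m0; set y : R := k.+1%:R.
have y1 : 1 <= y by rewrite ler1n.
have y0 : 0 < y by lra.
have [ym|ym] := leP (m / 2) y.
  apply: le_trans (_ : 2 / m <= _).
    by rewrite ler_pdivrMr// mulrAC ler_pdivlMr//; lra.
  by rewrite lerDl divr_ge0 ?sqr_ge0// mulr_ge0 ?sqr_ge0.
apply: le_trans (_ : 1 <= _); first by rewrite ler_pdivrMr//; lra.
apply: le_trans (_ : 4 * (y - m) ^+ 2 / m ^+ 2 <= _); last first.
  by rewrite lerDr divr_ge0// ltW.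
by rewrite ler_pdivlMr ?exprn_gt0// mul1r; nra.
Qed.

Lemma ln_prod (I : finType) (g : I -> R) : (forall i, 0 < g i) ->
  ln (\prod_i g i) = \sum_i ln (g i).
Proof.
move=> g0.
pose K (x y : R) := 0 < x /\ ln x = y.
suff [] : K (\prod_i g i) (\sum_i ln (g i)) by [].
apply: (big_ind2 K) => [|x1 x2 y1 y2 [x0 <-] [y0 <-]|i _]; rewrite /K.
- by rewrite ln1.
- by rewrite mulr_gt0// lnM.
- by [].
Qed.

(** With [ln_fact_lb] for the factorial, this bounds what a coordinate of mean
    [m] contributes to the logarithm of the ratio of the multinomial weight at
    [k] and the normal density at [k + w]; see [ln_ratio_le]. *)
Definition log_ratio_term m w k : R :=
  1 / (4 * k.+1%:R) - (k%:R + 1 / 2 - m) ^+ 2 / (2 * m)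
  + (k%:R + 1 / 2 - m) ^+ 3 / (6 * m ^+ 2) + (k%:R - m + w) ^+ 2 / (2 * m).

(** The terms of order [D ^ 2 / m] of Stirling's expansion and of the normal
    exponent cancel, and those that are left have means of order [1 / m]. *)
Lemma log_ratio_term_le m w k (D := k%:R - m) : 0 < m ->
  log_ratio_term m w k <=
    1 / (2 * m) + (D ^+ 2 + 2 * D + 1) / m ^+ 2
    + (D * (2 * w - 1) + w ^+ 2 - 1 / 4) / (2 * m)
    + (D ^+ 3 + 3 / 2 * D ^+ 2 + 3 / 4 * D + 1 / 8) / (6 * m ^+ 2).
Proof.
move=> m0; have := inv_succ_le k m0; rewrite -(natr1 k).
have ek : k%:R = D + m by rewrite /D subrK.
have K0 : 0 <= k%:R :> R by [].
rewrite /log_ratio_term -(natr1 k).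
have -> : 1 / (4 * (k%:R + 1)) = 1 / 4 * (1 / (k%:R + 1)) :> R.
  by field; rewrite gt_eqF//; lra.
move: (1 / (k%:R + 1)) => a; rewrite ek => h.
have {}h : 1 / 4 * a <= 1 / (2 * m) + (D ^+ 2 + 2 * D + 1) / m ^+ 2.
  have -> : 1 / (2 * m) + (D ^+ 2 + 2 * D + 1) / m ^+ 2 =
     1 / 4 * (2 / m + 4 * (D + m + 1 - m) ^+ 2 / m ^+ 2).
    by field; rewrite gt_eqF.
  by rewrite ler_pM2l.
apply: le_trans (_ : 1 / (2 * m) + (D ^+ 2 + 2 * D + 1) / m ^+ 2
   - (D + m + 1 / 2 - m) ^+ 2 / (2 * m)
   + (D + m + 1 / 2 - m) ^+ 3 / (6 * m ^+ 2) + (D + m - m + w) ^+ 2 / (2 * m) <= _).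
  by rewrite !lerD2r.
rewrite le_eqVlt; apply/orP; left; apply/eqP.
by field; rewrite gt_eqF.
Qed.

End coordinate_bounds.

Section multinomial_vs_normal.
Context {R : realType} (d n : nat) (p : 'I_d.+1 -> R).
Hypothesis n_gt0 : (0 < n)%N.
Hypothesis p_gt0 : forall i, 0 < p i.
Hypothesis p_sum1 : \sum_i p i = 1.
Let m i := n%:R * p i.
Let Q := multinomial_weight (n := n) p.
Let E (g : {ffun 'I_d.+1 -> 'I_n.+1} -> R) := \sum_(f <- compositions d n) Q f * g f.

Let N_gt0 : 0 < n%:R :> R. Proof. by rewrite ltr0n. Qed.

Let m_gt0 i : 0 < m i. Proof. by rewrite mulr_gt0. Qed.

Let p_le1 i : p i <= 1.
Proof. by rewrite -p_sum1 (bigD1 i)//= lerDl sumr_ge0// => j _; exact: ltW. Qed.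

Let Q_gt0 f : 0 < Q f.
Proof.
rewrite mulr_gt0 ?divr_gt0 ?ltr0n ?fact_gt0//.
  by apply: prodr_gt0 => i _; rewrite ltr0n fact_gt0.
by apply: prodr_gt0 => i _; rewrite exprn_gt0.
Qed.

Let E_binomial i j : E (fun f => 'C(f i, j)%:R) = 'C(n, j)%:R * p i ^+ j.
Proof.
by rewrite /E /compositions big_enum/= -multinomial_factorial_moment.
Qed.

Let ED g h : E (fun f => g f + h f) = E g + E h.
Proof. by rewrite -big_split/=; apply: eq_bigr => f _; rewrite mulrDr. Qed.

Let EZ c g : E (fun f => c * g f) = c * E g.
Proof. by rewrite /E mulr_sumr; apply: eq_bigr => f _; rewrite mulrCA. Qed.

Let eqE g h : g =1 h -> E g = E h.
Proof. by move=> gh; apply: eq_bigr => f _; rewrite gh. Qed.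

Lemma multinomial_sum1 : \sum_(f <- compositions d n) Q f = 1.
Proof.
have := E_binomial ord0 0; rewrite bin0 mul1r expr0 => <-.
by apply: eq_bigr => f _; rewrite bin0 mulr1.
Qed.

Let E1 : E (fun=> 1) = 1.
Proof. by rewrite -[RHS]multinomial_sum1; apply: eq_bigr => f _; rewrite mulr1. Qed.

Let Ec c : E (fun=> c) = c.
Proof. by rewrite -[RHS]mulr1 -[in RHS]E1 -EZ; apply: eqE => f; rewrite mulr1. Qed.

Lemma bin2_natr k : 'C(k, 2)%:R = k%:R * (k%:R - 1) / 2 :> R.
Proof.
have := bin_ffact k 2 => /(congr1 (fun x => x%:R : R)).
rewrite (_ : 2`! = 2%N)// ffactnS ffactn1 !natrM.
case: k => [|k] /=; [|rewrite -(natr1 k)] => h; lra.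
Qed.

Lemma bin3_natr k : 'C(k, 3)%:R = k%:R * (k%:R - 1) * (k%:R - 2) / 6 :> R.
Proof.
have := bin_ffact k 3 => /(congr1 (fun x => x%:R : R)).
rewrite (_ : 3`! = 6%N)// !ffactnS ffactn0 muln1 !natrM.
case: k => [|[|k]] /=.
- by move=> _; rewrite !mul0r.
- by move=> _; rewrite subrr mulr0 !mul0r.
- by rewrite -(natr1 k.+1) -(natr1 k) => h; lra.
Qed.

Let E_1 i : E (fun f => (f i)%:R) = m i.
Proof.
have := E_binomial i 1; rewrite bin1 expr1 -/(m i) => <-.
by apply: eqE => f; rewrite bin1.
Qed.

Let E_2 i : E (fun f => (f i)%:R ^+ 2) = m i ^+ 2 + m i * (1 - p i).
Proof.
rewrite (@eqE _ (fun f => 2 * 'C(f i, 2)%:R + (f i)%:R)); last first.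
  by move=> f; rewrite bin2_natr; field.
by rewrite ED EZ E_binomial E_1 bin2_natr /m; field.
Qed.

Let E_3 i : E (fun f => (f i)%:R ^+ 3) =
  n%:R * (n%:R - 1) * (n%:R - 2) * p i ^+ 3 + 3 * (m i ^+ 2 + m i * (1 - p i)) - 2 * m i.
Proof.
rewrite (@eqE _ (fun f => 6 * 'C(f i, 3)%:R + (3 * (f i)%:R ^+ 2 + (- 2) * (f i)%:R))).
  by rewrite ED ED !EZ E_binomial E_1 E_2 bin3_natr /m; field.
by move=> f; rewrite bin3_natr; field.
Qed.

Lemma multinomial_central1 i : E (fun f => (f i)%:R - m i) = 0.
Proof. by rewrite ED E_1 Ec subrr. Qed.

Lemma multinomial_central2 i : E (fun f => ((f i)%:R - m i) ^+ 2) = m i * (1 - p i).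
Proof.
rewrite (@eqE _ (fun f => (f i)%:R ^+ 2 + ((- 2 * m i) * (f i)%:R + m i ^+ 2))).
  by rewrite ED ED EZ E_1 E_2 Ec; ring.
by move=> f; ring.
Qed.

Lemma multinomial_central3 i : E (fun f => ((f i)%:R - m i) ^+ 3) =
  m i * ((1 - p i) * (1 - 2 * p i)).
Proof.
rewrite (@eqE _ (fun f => (f i)%:R ^+ 3 + ((- 3 * m i) * (f i)%:R ^+ 2
   + ((3 * m i ^+ 2) * (f i)%:R + - m i ^+ 3)))).
  by rewrite ED ED ED !EZ E_1 E_2 E_3 Ec /m; ring.
by move=> f; ring.
Qed.

(** The first central moment of a binomial law vanishes and the next two are at
    most its mean [m]. As [m >= 1], the terms in [1 / m ^ 2] are absorbed. *)
Lemma mean_log_ratio_term i (w : R) : 1 <= m i ->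
  E (fun f => log_ratio_term (m i) w (f i)) <= 3 / m i + w ^+ 2 / (2 * m i).
Proof.
move=> m1; have mi0 := m_gt0 i.
pose a := m i.
pose A : R := 1 / a ^+ 2 + (3 / 2) / (6 * a ^+ 2).
pose B : R := 2 / a ^+ 2 + (2 * w - 1) / (2 * a) + (3 / 4) / (6 * a ^+ 2).
pose C : R := 1 / (2 * a) + 1 / a ^+ 2 + (w ^+ 2 - 1 / 4) / (2 * a)
   + (1 / 8) / (6 * a ^+ 2).
pose G := 1 / (6 * a ^+ 2).
pose D (f : {ffun 'I_d.+1 -> 'I_n.+1}) : R := (f i)%:R - a.
apply: le_trans (_ : E (fun f => G * D f ^+ 3 + (A * D f ^+ 2 + (B * D f + C))) <= _).
  apply: ler_sum => f _; apply: ler_wpM2l; first exact: ltW.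
  apply: le_trans (log_ratio_term_le w (f i) mi0) _.
  rewrite le_eqVlt; apply/orP; left; apply/eqP.
  by rewrite /G /A /B /C -/a /D; field; rewrite gt_eqF.
rewrite ED ED ED !EZ Ec multinomial_central1 multinomial_central2 multinomial_central3.
have p0 := p_gt0 i; have p1 := p_le1 i.
have G0 : 0 <= G by rewrite divr_ge0// mulr_ge0 ?sqr_ge0.
have A0 : 0 <= A.
  have a2 : 0 <= a ^+ 2 by exact: sqr_ge0.
  by apply: addr_ge0; apply: divr_ge0; lra.
have h3 : G * (m i * ((1 - p i) * (1 - 2 * p i))) <= G * m i.
  by rewrite ler_wpM2l// ger_pMr//; nra.
have h2 : A * (m i * (1 - p i)) <= A * m i.
  by rewrite ler_wpM2l// ger_pMr//; lra.
apply: le_trans (_ : G * m i + (A * m i + (B * 0 + C)) <= _).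
  by rewrite !lerD.
rewrite mulr0 add0r -/a -subr_ge0.
have -> : 3 / a + w ^+ 2 / (2 * a) - (G * a + (A * a + C)) =
    (29 / 24 * a - 49 / 48) / a ^+ 2.
  by rewrite /G /A /C; field; rewrite gt_eqF.
by rewrite divr_ge0 ?sqr_ge0//; move: m1; rewrite -/a; lra.
Qed.

Lemma ln_multinomial_weight f : f \in compositions d n ->
  ln (Q f) = (ln n`!%:R - n%:R * ln n%:R) -
    \sum_i (ln (f i)`!%:R - (f i)%:R * ln (m i)).
Proof.
rewrite mem_compositions => /eqP fn.
have fact0 k : 0 < k`!%:R :> R by rewrite ltr0n fact_gt0.
have pfact : 0 < \prod_i (f i)`!%:R :> R by apply: prodr_gt0.
have ppow : 0 < \prod_i p i ^+ f i by apply: prodr_gt0 => i _; rewrite exprn_gt0.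
rewrite /Q /multinomial_weight [LHS]lnM ?posrE ?divr_gt0//.
rewrite [X in X + _]ln_div ?posrE// !ln_prod//; last by move=> i; rewrite exprn_gt0.
rewrite -addrA -[in RHS]addrA; congr (_ + _).
rewrite sumrB opprB [RHS]addrA [LHS]addrC; congr (_ - _).
have -> : n%:R * ln n%:R = \sum_i (f i)%:R * ln n%:R :> R.
  by rewrite -mulr_suml -natr_sum fn.
rewrite addrC -sumrB; apply: eq_bigr => i _.
rewrite lnXn// /m lnM ?posrE// -mulr_natl.
by ring.
Qed.

(** The normal density at the point [f + w] of the hyperplane of vectors of
    sum [n], when the entries of [w] sum to [0]; see [normal_density_shift]. *)
Definition normal_weight (w : 'I_d.+1 -> R) (f : {ffun 'I_d.+1 -> 'I_n.+1}) : R :=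
  (\prod_i gauss (m i) ((f i)%:R - m i + w i)) / gauss n%:R 0.

Lemma ln_normal_weight w f : ln (normal_weight w f) =
  ln (2 * pi) / 2 + ln n%:R / 2
  - \sum_i (ln (2 * pi) / 2 + ln (m i) / 2 + ((f i)%:R - m i + w i) ^+ 2 / (2 * m i)).
Proof.
have gp i : 0 < gauss (m i) ((f i)%:R - m i + w i) by exact: gauss_gt0.
rewrite /normal_weight ln_div ?posrE ?gauss_gt0//; last by apply: prodr_gt0.
rewrite ln_prod// ln_gauss// expr0n/= mul0r subr0.
under eq_bigr => i _ do rewrite ln_gauss// -!opprD.
by rewrite sumrN addrC opprD !opprK.
Qed.

Lemma ln_ratio_le w f : f \in compositions d n ->
  ln (Q f) - ln (normal_weight w f) <=
  1 / (4 * n%:R) + \sum_i log_ratio_term (m i) (w i) (f i).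
Proof.
move=> fn; rewrite ln_multinomial_weight// ln_normal_weight.
have sm : \sum_i m i = n%:R by rewrite -mulr_sumr p_sum1 mulr1.
have hn := ln_fact_ub (R := R) n_gt0.
have hi : \sum_i (- m i + ln (2 * pi) / 2 + ln (m i) / 2
     + ((f i)%:R + 1 / 2 - m i) ^+ 2 / (2 * m i)
     - ((f i)%:R + 1 / 2 - m i) ^+ 3 / (6 * m i ^+ 2) - 1 / (4 * (f i).+1%:R))
   <= \sum_i (ln (f i)`!%:R - (f i)%:R * ln (m i)).
  by apply: ler_sum => i _; exact: ln_fact_lb.
have e : \sum_i log_ratio_term (m i) (w i) (f i) =
  \sum_i (ln (2 * pi) / 2 + ln (m i) / 2 + ((f i)%:R - m i + w i) ^+ 2 / (2 * m i))
  - \sum_i (- m i + ln (2 * pi) / 2 + ln (m i) / 2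
     + ((f i)%:R + 1 / 2 - m i) ^+ 2 / (2 * m i)
     - ((f i)%:R + 1 / 2 - m i) ^+ 3 / (6 * m i ^+ 2) - 1 / (4 * (f i).+1%:R))
  - \sum_i m i.
  by rewrite -!sumrB; apply: eq_bigr => i _; rewrite /log_ratio_term; ring.
rewrite e sm; move: hn hi; move: (1 / (4 * n%:R)) => c.
by lra.
Qed.

(** The normalizing factors of the two sides contribute [1 / (4 n)], which is
    less than one of the terms [1 / m_i]. *)
Lemma relative_entropy_le w : (forall i, 1 <= m i) ->
  \sum_(f <- compositions d n) Q f * (ln (Q f) - ln (normal_weight w f)) <=
  \sum_i (4 / m i + w i ^+ 2 / (2 * m i)).
Proof.
move=> m1.
apply: le_trans (_ : 1 / (4 * n%:R) + \sum_i (3 / m i + w i ^+ 2 / (2 * m i)) <= _).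
  apply: le_trans (_ : E (fun f => 1 / (4 * n%:R) +
      \sum_i log_ratio_term (m i) (w i) (f i)) <= _).
    rewrite /E big_seq [leRHS]big_seq; apply: ler_sum => f fn.
    by apply: ler_wpM2l; [exact: ltW|exact: ln_ratio_le].
  rewrite ED Ec lerD2l.
  rewrite {1}/E; under eq_bigr do rewrite mulr_sumr.
  by rewrite exchange_big/=; apply: ler_sum => i _; exact: mean_log_ratio_term.
have -> : \sum_i (4 / m i + w i ^+ 2 / (2 * m i)) =
   \sum_i 1 / m i + \sum_i (3 / m i + w i ^+ 2 / (2 * m i)).
  by rewrite -big_split/=; apply: eq_bigr => i _; ring.
rewrite lerD2r (bigD1 ord0)//= -[leLHS]addr0 lerD//; last first.
  by apply: sumr_ge0 => i _; rewrite divr_ge0// ltW.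
rewrite !div1r lef_pV2 ?posrE ?mulr_gt0//.
have : m ord0 <= n%:R by rewrite ger_pMr// p_le1.
by have := N_gt0; lra.
Qed.

End multinomial_vs_normal.

(** * From entropy to total variation *)

Section entropy.
Context {R : realType}.

(** Where [h < Q], put [z = 1 - h / Q]: then [h - Q + Q (ln Q - ln h)] is at
    least [Q z ^ 2 / 2], and [t z <= t ^ 2 / 2 + z ^ 2 / 2]. Elsewhere it is
    nonnegative by [ln x <= x - 1]. *)
Lemma excess_le_entropy (t Q h : R) : 0 < Q -> 0 < h ->
  t * excess Q h <= t ^+ 2 / 2 * Q + h - Q + Q * (ln Q - ln h).
Proof.
move=> Q0 h0; have hQ : 0 < h / Q by rewrite divr_gt0.
rewrite /excess; case: (leP (Q - h) 0) => Qh.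
  have := ln_le_sub1 hQ; rewrite ln_div ?posrE// -(ler_pM2l Q0).
  rewrite (_ : Q * (h / Q - 1) = h - Q); last by field; rewrite gt_eqF.
  by have := mulr_ge0 (sqr_ge0 t) (ltW Q0); lra.
set z := 1 - h / Q.
have z01 : 0 <= z < 1.
  rewrite /z subr_ge0 ler_pdivrMr// mul1r; apply/andP; split; first lra.
  by rewrite ltrBlDr ltrDl.
have := ln1B_le z01; rewrite {1}/z subKr ln_div ?posrE// => hz.
have e : Q - h = Q * z by rewrite /z; field; rewrite gt_eqF.
have {}e : h = Q - Q * z by rewrite -e; ring.
have hz' : Q * (z + z ^+ 2 / 2) <= Q * (ln Q - ln h) by rewrite ler_pM2l//; lra.
have sq : 0 <= Q * (t - z) ^+ 2 by rewrite mulr_ge0 ?sqr_ge0// ltW.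
move: hz'; set L := Q * (ln Q - ln h) => hz'; rewrite e.
have e2 : Q * (t - z) ^+ 2 = Q * t ^+ 2 - 2 * (t * (Q * z)) + Q * z ^+ 2 by ring.
by rewrite e2 in sq; lra.
Qed.

Context {disp : measure_display} {T : measurableType disp}.
Variables (m : {measure set T -> \bar R}) (D : set T).
Hypothesis mD : measurable D.
Hypothesis D1 : (m D = 1)%E.
Local Open Scope ereal_scope.

(** A form of Pinsker's inequality. Once [excess_le_entropy] is summed over [s]
    and integrated, the terms [h - Q] contribute at most [1 - 1 = 0]. *)
Lemma integral_excess_le_entropy (I : eqType) (s : seq I) (Q : I -> R) (h : I -> T -> R)
    (B : T -> R) (kappa : R) :
  (forall i, 0 < Q i)%R -> (\sum_(i <- s) Q i = 1)%R ->
  (forall i x, 0 < h i x)%R -> (forall i, measurable_fun D (h i)) ->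
  \sum_(i <- s) \int[m]_(x in D) (h i x)%:E <= 1 ->
  measurable_fun D B ->
  (forall x, D x -> 0 <= B x)%R ->
  (forall x, D x -> \sum_(i <- s) Q i * (ln (Q i) - ln (h i x)) <= B x)%R ->
  (0 < kappa)%R -> \int[m]_(x in D) (B x)%:E <= kappa%:E ->
  \sum_(i <- s) \int[m]_(x in D) (excess (Q i) (h i x))%:E <= (Num.sqrt (2 * kappa))%:E.
Proof.
move=> Q0 Q1 h0 mh hle1 mB B0 QhB k0 Bk.
(* This [t] minimizes the resulting bound [t / 2 + kappa / t]. *)
pose t := Num.sqrt (2 * kappa).
have t0 : (0 < t)%R by rewrite sqrtr_gt0 mulr_gt0.
have tt : (t ^+ 2 = 2 * kappa)%R by rewrite sqr_sqrtr// mulr_ge0// ltW.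
have mex i : measurable_fun D (fun x => (excess (Q i) (h i x))%:E).
  apply/measurable_EFinP; apply: measurable_maxr => //.
  exact: measurable_funB.
have ex0 i x : D x -> 0 <= (excess (Q i) (h i x))%:E.
  by rewrite lee_fin excess_ge0.
have mhE i : measurable_fun D (fun x => (h i x)%:E) by exact/measurable_EFinP.
have h0E i x : D x -> 0 <= (h i x)%:E by rewrite lee_fin ltW.
have mBE : measurable_fun D (fun x => (B x)%:E) by exact/measurable_EFinP.
have B0E x : D x -> 0 <= (B x)%:E by move=> Dx; rewrite lee_fin B0.
rewrite -ge0_integral_sum// in hle1.
rewrite -ge0_integral_sum//.
have msum : measurable_fun D (fun x => \sum_(i <- s) (h i x)%:E).
  by apply: emeasurable_sum.
have msumex : measurable_fun D (fun x => \sum_(i <- s) (excess (Q i) (h i x))%:E).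
  by apply: emeasurable_sum.
have sum0 x : D x -> 0 <= \sum_(i <- s) (h i x)%:E.
  by move=> Dx; apply: sume_ge0 => i _; exact: h0E.
have sumex0 x : D x -> 0 <= \sum_(i <- s) (excess (Q i) (h i x))%:E.
  by move=> Dx; apply: sume_ge0 => i _; exact: ex0.
have int1 c : \int[m]_(x in D) (cst c%:E) x = c%:E.
  by rewrite integral_cst// D1 mule1.
have key : t%:E * \int[m]_(x in D) \sum_(i <- s) (excess (Q i) (h i x))%:E + 1%:E
   <= (t ^+ 2 / 2)%:E + \int[m]_(x in D) \sum_(i <- s) (h i x)%:E
      + \int[m]_(x in D) (B x)%:E.
  have t2 : (0 <= t ^+ 2 / 2)%R by rewrite divr_ge0 ?sqr_ge0.
  rewrite -ge0_integralZl//; last by rewrite lee_fin ltW.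
  rewrite -(int1 1%R) -(int1 (t ^+ 2 / 2)%R) -ge0_integralD//; last 2 first.
  - by move=> x Dx; rewrite mule_ge0 ?sumex0// lee_fin ltW.
  - exact: measurable_funeM.
  rewrite -ge0_integralD// -ge0_integralD//; last 2 first.
  - by move=> x Dx; rewrite adde_ge0 ?sum0.
  - exact: emeasurable_funD.
  apply: ge0_le_integral => //.
  - move=> x Dx; rewrite adde_ge0// mule_ge0 ?sumex0// lee_fin ltW//.
  - by apply: emeasurable_funD => //; exact: measurable_funeM.
  - by apply: emeasurable_funD => //; exact: emeasurable_funD.
  move=> x Dx; rewrite !sumEFin -EFinM -!EFinD lee_fin.
  apply: le_trans (_ : t ^+ 2 / 2 + \sum_(i <- s) h i x
      + \sum_(i <- s) Q i * (ln (Q i) - ln (h i x)) <= _)%R; last first.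
    by rewrite lerD2l QhB.
  have tQ : (t ^+ 2 / 2 = \sum_(i <- s) t ^+ 2 / 2 * Q i)%R.
    by rewrite -mulr_sumr Q1 mulr1.
  rewrite -[X in (_ + X <= _)%R]Q1 [X in (_ <= X + _ + _)%R]tQ mulr_sumr -!big_split/=.
  apply: ler_sum => i _.
  by have := excess_le_entropy t (Q0 i) (h0 i x); lra.
(* Finiteness allows the term [1] to be cancelled. *)
have fin : \int[m]_(x in D) \sum_(i <- s) (excess (Q i) (h i x))%:E \is a fin_num.
  rewrite ge0_fin_numE; last exact: integral_ge0.
  rewrite ltey; apply/negP => /eqP oo; move: key.
  rewrite oo gt0_muley ?lte_fin// addye// leye_eq => /eqP.
  have := lt_le_trans; move: hle1 Bk.
  case: (\int[m]_(x in D) \sum_(i <- s) (h i x)%:E) => //.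
  by case: (\int[m]_(x in D) (B x)%:E).
have {}key : t%:E * \int[m]_(x in D) \sum_(i <- s) (excess (Q i) (h i x))%:E + 1%:E
   <= (t ^+ 2 / 2)%:E + 1 + kappa%:E.
  by apply: le_trans key _; apply: leeD => //; exact: leeD.
move: fin key; case: (\int[m]_(x in D) _) => // J _.
rewrite -EFinM -!EFinD lee_fin -/t => key.
rewrite lee_fin -(ler_pM2l t0) -expr2 tt.
by move: key; rewrite tt; lra.
Qed.

End entropy.

(** * Densities constant on cells *)

Section cell_sums.
Context {R : realType} (d n : nat).
Local Open Scope ereal_scope.
Local Notation leb := (lebesgue_tuple R d).
Local Notation comps := (compositions d n).
Local Notation point := (@point R d n).

Lemma sum_cell_in (h : {ffun 'I_d.+1 -> 'I_n.+1} -> R) g x :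
  g \in comps -> cell (point g) x ->
  (\sum_(f <- comps) h f * \1_(cell (point f)) x = h g)%R.
Proof.
move=> gn gx; rewrite (bigD1_seq g) ?compositions_uniq//=.
rewrite indicE mem_set// mulr1 big_seq_cond big1 ?addr0// => f /andP[fn fg].
rewrite indicE memNset ?mulr0// => fx; move/eqP: fg; apply.
by apply: (@trivIset_cell R d n f g fn gn); exists x.
Qed.

Lemma sum_cell_out (h : {ffun 'I_d.+1 -> 'I_n.+1} -> R) x :
  (forall g, g \in comps -> ~ cell (point g) x) ->
  (\sum_(f <- comps) h f * \1_(cell (point f)) x = 0)%R.
Proof.
move=> hx; rewrite big_seq big1// => f fn.
by rewrite indicE memNset ?mulr0//; exact: hx.
Qed.

Lemma integral_mul_cell f (g : d.-tuple R -> R) :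
  measurable_fun setT g -> (forall x, 0 <= g x)%R ->
  \int[leb]_x (g x * \1_(cell (point f)) x)%:E =
  \int[leb]_(v in @cube R d) (g (tuple_add v (point f)))%:E.
Proof.
move=> mg g0; rewrite -(@ge0_integral_cell _ _ _ (fun x => (g x)%:E)); last 2 first.
- exact/measurable_EFinP.
- by move=> x; rewrite lee_fin.
rewrite [RHS]integral_mkcond; apply: eq_integral => x _.
by rewrite patchE indicE; case: ifP => _; rewrite ?mulr1 ?mulr0.
Qed.

Variable phi : d.-tuple R -> R.
Hypothesis mphi : measurable_fun setT phi.
Hypothesis phi0 : forall x, (0 <= phi x)%R.
Hypothesis phi1 : \int[leb]_x (phi x)%:E = 1.

Let mphi_cell f : measurable_fun setT (fun x => (phi x * \1_(cell (point f)) x)%R).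
Proof.
apply: measurable_funM => //; apply: measurable_indic; exact: measurable_cell.
Qed.

(** The cells are disjoint. *)
Lemma sum_integral_cell_le1 :
  \sum_(f <- comps) \int[leb]_(v in @cube R d) (phi (tuple_add v (point f)))%:E <= 1.
Proof.
under eq_bigr => f _ do rewrite -integral_mul_cell//.
rewrite -ge0_integral_sum//; last 2 first.
- by move=> f; apply/measurable_EFinP; exact: mphi_cell.
- by move=> f x _; rewrite lee_fin mulr_ge0.
rewrite -phi1; apply: ge0_le_integral => //.
- by move=> x _; apply: sume_ge0 => f _; rewrite lee_fin mulr_ge0.
- by apply: emeasurable_sum => f; apply/measurable_EFinP; exact: mphi_cell.
- exact/measurable_EFinP.
move=> x _; rewrite sumEFin lee_fin.
have [[g gn gx]|hx] := pselect (exists2 g, g \in comps & cell (point g) x).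
  by rewrite (sum_cell_in (fun=> phi x) gn gx).
rewrite (sum_cell_out (fun=> phi x))// => g gn gx.
by apply: hx; exists g.
Qed.

(** A point lies in at most one cell, and outside the cells there is no excess
    because [phi] is nonnegative. *)
Lemma integral_excess_cells_le (w : {ffun 'I_d.+1 -> 'I_n.+1} -> R) :
  \int[leb]_x (excess (\sum_(f <- comps) w f * \1_(cell (point f)) x)%R (phi x))%:E <=
  \sum_(f <- comps) \int[leb]_(v in @cube R d)
    (excess (w f) (phi (tuple_add v (point f))))%:E.
Proof.
have mexc f : measurable_fun setT (fun x => excess (w f) (phi x)).
  exact: (@measurable_excess _ _ _ (fun=> w f)).
have mexcc f : measurable_fun setT
    (fun x => (excess (w f) (phi x) * \1_(cell (point f)) x)%:E).
  apply/measurable_EFinP; apply: measurable_funM => //.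
  by apply: measurable_indic; exact: measurable_cell.
have -> : \sum_(f <- comps) \int[leb]_(v in @cube R d)
      (excess (w f) (phi (tuple_add v (point f))))%:E =
    \sum_(f <- comps) \int[leb]_x (excess (w f) (phi x) * \1_(cell (point f)) x)%:E.
  apply: eq_bigr => f _.
  rewrite (@integral_mul_cell f (fun x => excess (w f) (phi x)))//.
  by move=> x; exact: excess_ge0.
rewrite -ge0_integral_sum//.
- apply: ge0_le_integral => //.
  + by move=> x _; rewrite lee_fin excess_ge0.
  + apply/measurable_EFinP; apply: measurable_excess => //.
    apply: measurable_sum => f; apply: measurable_funM => //.
    by apply: measurable_indic; exact: measurable_cell.
  + by apply: emeasurable_sum.
  + move=> x _; rewrite sumEFin lee_fin.
    have [[g gn gx]|hx] := pselect (exists2 g, g \in comps & cell (point g) x).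
      by rewrite (sum_cell_in (fun f => excess (w f) (phi x)) gn gx) (sum_cell_in w gn gx).
    rewrite !sum_cell_out => [|g gn gx|g gn gx]; [|by apply: hx; exists g..].
    by rewrite /excess sub0r ge_max lexx oppr_le0 phi0.
- by move=> f x _; rewrite lee_fin mulr_ge0 ?excess_ge0.
Qed.

End cell_sums.

(** * Sampling with and without replacement *)

Section sampling.
Context {R : realType} (d N n : nat) (p : d.-tuple R).
Hypothesis adm : admissible N n p.
Let N_gt0 : (0 < N)%N. Proof. by case: adm. Qed.
Let n_gt0 : (0 < n)%N. Proof. by case: adm. Qed.
Let NR : 0 < N%:R :> R. Proof. by rewrite ltr0n. Qed.
Let nR : 0 < n%:R :> R. Proof. by rewrite ltr0n. Qed.

Lemma admissible_le : (n <= N)%N.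
Proof.
have [_ _ nN _ _] := adm; rewrite -(@ler_nat R).
by have := NR; move: nN; lra.
Qed.

Lemma admissible_gt0 i : 0 < tnth p i.
Proof. by have [_ _ _ _ [/(_ i)/andP[]]] := adm. Qed.

Lemma norm1_sum : norm1 p = \sum_(i < d) tnth p i.
Proof. by apply: eq_bigr => i _; rewrite gtr0_norm// admissible_gt0. Qed.

Lemma tnth_pbar_widen i : tnth (pbar p) (widen_ord (leqnSn d) i) = tnth p i.
Proof. by rewrite (tnth_nth 0)/= nth_rcons size_tuple ltn_ord -tnth_nth. Qed.

Lemma tnth_pbar_max : tnth (pbar p) ord_max = 1 - \sum_(i < d) tnth p i.
Proof. by rewrite (tnth_nth 0)/= nth_rcons size_tuple ltnn eqxx norm1_sum. Qed.

Lemma pbar_sum1 : \sum_i tnth (pbar p) i = 1.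
Proof.
rewrite big_ord_recr/= tnth_pbar_max; under eq_bigr do rewrite tnth_pbar_widen.
by rewrite addrC subrK.
Qed.

Lemma ord_widen_or_max (i : 'I_d.+1) :
  (exists j, i = widen_ord (leqnSn d) j) \/ i = ord_max.
Proof.
have [id|di] := ltnP i d; first by left; exists (Ordinal id); apply/val_inj.
by right; apply/val_inj/eqP; rewrite eqn_leq di -ltnS ltn_ord.
Qed.

Lemma pbar_gt0 i : 0 < tnth (pbar p) i.
Proof.
have [[j ->]|->] := ord_widen_or_max i; first by rewrite tnth_pbar_widen admissible_gt0.
rewrite tnth_pbar_max -norm1_sum subr_gt0.
by have [_ _ _ _ []] := adm.
Qed.

Lemma admissible_rest_gt0 : 0 < 1 - \sum_(i < d) tnth p i.
Proof. by rewrite -tnth_pbar_max pbar_gt0. Qed.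

Lemma pbar_lattice i : N%:R * tnth (pbar p) i \is a Num.nat.
Proof.
have [_ _ _ lat _] := adm.
have [[j ->]|->] := ord_widen_or_max i; first by rewrite tnth_pbar_widen; exact: lat.
rewrite natrEint; apply/andP; split; last by rewrite mulr_ge0// ltW// pbar_gt0.
rewrite tnth_pbar_max mulrBr mulr1 rpredB//.
  by rewrite intr_nat.
rewrite mulr_sumr rpred_sum// => j _.
by have := lat j; rewrite natrEint => /andP[].
Qed.

Let M i := Num.truncn (N%:R * tnth (pbar p) i).

Let MR i : (M i)%:R = N%:R * tnth (pbar p) i.
Proof. by rewrite /M truncnK// pbar_lattice. Qed.

(** The probability that [n] draws with replacement from [N] are distinct. *)
Definition distinct_prob : R := (N ^_ n)%:R / N%:R ^+ n.

Lemma distinct_prob_gt0 : 0 < distinct_prob.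
Proof. by rewrite divr_gt0 ?exprn_gt0// ltr0n ffact_gt0 admissible_le. Qed.

(** A union bound over the pairs of draws. *)
Lemma distinct_prob_lb : 1 - n%:R ^+ 2 / (2 * N%:R) <= distinct_prob.
Proof.
rewrite /distinct_prob.
have : (n <= N)%N := admissible_le.
elim: n => [|k ih] kN; first by rewrite expr0n mul0r subr0 expr0 divr1.
have kN' : (k <= N)%N by exact: ltnW.
rewrite ffactnSr natrM natrB// (exprSr _ k).
have -> : (N ^_ k)%:R * (N%:R - k%:R) / (N%:R ^+ k * N%:R) =
    (N ^_ k)%:R / N%:R ^+ k * (1 - k%:R / N%:R) :> R.
  have NX : 0 < N%:R ^+ k :> R by rewrite exprn_gt0.
  by move: NX (N ^_ k) => NX F; field; rewrite !gt_eqF.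
have c0 : 0 <= 1 - k%:R / N%:R :> R.
  by rewrite subr_ge0 ler_pdivrMr// mul1r ler_nat.
apply: le_trans (ler_wpM2r c0 (ih kN')).
rewrite -subr_ge0 -(natr1 k).
have -> : (1 - k%:R ^+ 2 / (2 * N%:R)) * (1 - k%:R / N%:R) -
    (1 - (k%:R + 1) ^+ 2 / (2 * N%:R)) =
    (k%:R ^+ 3 / N%:R + 1) / (2 * N%:R) :> R.
  by field; rewrite gt_eqF.
by rewrite divr_ge0 ?mulr_ge0// addr_ge0// divr_ge0// exprn_ge0.
Qed.

(** A sample drawn with replacement has distinct elements with probability
    [distinct_prob], and is then distributed as a sample drawn without. In
    formulas, falling factorials are at most powers. *)
Lemma hypergeometric_le_multinomial f : f \in compositions d n ->
  distinct_prob * hypergeometric_pmf N n p (head_vec f) <=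
  multinomial_weight (tnth (pbar p)) f.
Proof.
move=> fn; have /eqP sf : (\sum_i f i == n)%N by rewrite -mem_compositions.
rewrite /hypergeometric_pmf /multinomial_weight.
rewrite (eq_bigr (fun i => 'C(M i, f i)%:R : R)); last first.
  by move=> i _; rewrite kbar_head_vec.
have f0 k : 0 < k`!%:R :> R by rewrite ltr0n fact_gt0.
have binE a k : 'C(a, k)%:R = (a ^_ k)%:R / k`!%:R :> R.
  by rewrite -bin_ffact natrM mulfK// gt_eqF.
rewrite binE; under eq_bigr do rewrite binE.
rewrite big_split/= prodfV.
have F0 : 0 < (N ^_ n)%:R :> R by rewrite ltr0n ffact_gt0 admissible_le.
have P0 : 0 < \prod_i (f i)`!%:R :> R by apply: prodr_gt0.
have NX : 0 < N%:R ^+ n :> R by rewrite exprn_gt0.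
have -> : \prod_i tnth (pbar p) i ^+ f i = (\prod_i (M i)%:R ^+ f i) / N%:R ^+ n.
  under [in RHS]eq_bigr do rewrite MR exprMn.
  by rewrite big_split/= prodrXr sf mulrAC mulfV ?mul1r// gt_eqF.
have le_pow : \prod_i (M i ^_ f i)%:R <= \prod_i (M i)%:R ^+ f i :> R.
  apply: ler_prod => i _; rewrite ler0n/= -natrX ler_nat.
  by elim: (nat_of_ord (f i)) => // k ih; rewrite ffactnSr expnSr leq_mul// leq_subr.
rewrite /distinct_prob; move: F0 P0 NX le_pow.
set F := (N ^_ n)%:R; set G := \prod_i (f i)`!%:R; set X := N%:R ^+ n.
set A := \prod_i (M i ^_ f i)%:R; set B := \prod_i (M i)%:R ^+ f i.
move=> F0 P0 NX AB; have n0 := f0 n.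
have -> : F / X * (A / G / (F / n`!%:R)) = n`!%:R / (G * X) * A.
  by move: n0; set b := n`!%:R => n0; field; rewrite !gt_eqF.
have -> : n`!%:R / G * (B / X) = n`!%:R / (G * X) * B.
  by move: n0; set b := n`!%:R => n0; field; rewrite !gt_eqF.
by apply: ler_wpM2l => //; rewrite divr_ge0// ltW// mulr_gt0.
Qed.

Lemma hypergeometric_pmf_ge0 k : 0 <= hypergeometric_pmf N n p k.
Proof. by rewrite divr_ge0//; apply: prodr_ge0. Qed.

Lemma hypergeometric_sub : hypergeometric_support N n p `<=` @multinomial_support d n.
Proof. by move=> k []. Qed.

Lemma hypergeometric_pmf_supp k : @multinomial_support d n k ->
  ~ hypergeometric_support N n p k -> hypergeometric_pmf N n p k = 0.
Proof.
move=> kn /not_andP[//|/existsNP[i /negP]]; rewrite -ltNge => ki.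
rewrite /hypergeometric_pmf (bigD1 i)//= bin_small ?mul0r//.
by rewrite -(ltr_nat R) -/(M i) MR.
Qed.

(** Both [n ^ 2 / N] and [2] are upper bounds, and
    [min (x, 2) <= sqrt (2 x)]. *)
Lemma sum_excess_hypergeometric :
  \sum_(f <- compositions d n) hypergeometric_pmf N n p (head_vec f) = 1 ->
  2 * \sum_(f <- compositions d n) excess (hypergeometric_pmf N n p (head_vec f))
        (multinomial_weight (tnth (pbar p)) f)
  <= Num.sqrt (2 * (n%:R ^+ 2 / N%:R)).
Proof.
move=> P1.
have le_rho : \sum_(f <- compositions d n) excess (hypergeometric_pmf N n p (head_vec f))
        (multinomial_weight (tnth (pbar p)) f) <= 1 - distinct_prob.
  rewrite -[leRHS]mulr1 -[X in _ * X]P1 mulr_sumr big_seq [leRHS]big_seq.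
  apply: ler_sum => f fn; have := hypergeometric_le_multinomial fn.
  have := hypergeometric_pmf_ge0 (head_vec f).
  have rho1 : distinct_prob <= 1.
    rewrite ler_pdivrMr ?exprn_gt0// mul1r -natrX ler_nat.
    by elim: (n) => // k ih; rewrite ffactnSr expnSr leq_mul// leq_subr.
  rewrite /excess ge_max => P0 h; apply/andP; split; first by lra.
  by rewrite mulr_ge0// subr_ge0.
set x := n%:R ^+ 2 / N%:R.
have x0 : 0 <= x by rewrite divr_ge0// sqr_ge0.
have rho0 := distinct_prob_gt0; have := distinct_prob_lb.
have -> : n%:R ^+ 2 / (2 * N%:R) = x / 2 by rewrite /x; field; rewrite gt_eqF.
move=> rhox.
have [x2|x2] := leP x 2.
  apply: le_trans (_ : x <= _); first by lra.
  rewrite -[leLHS](ger0_norm x0) -sqrtr_sqr ler_wsqrtr//.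
  by rewrite expr2 ler_wpM2r.
apply: le_trans (_ : 2 <= _); first by lra.
rewrite -[leLHS](@ger0_norm _ 2)// -sqrtr_sqr ler_wsqrtr//.
by rewrite expr2; lra.
Qed.

End sampling.

(** * Comparison with the normal density *)

Section balance.
Context {R : realType} (d N n : nat) (p : d.-tuple R).
Hypothesis adm : admissible N n p.
Hypothesis d_gt0 : (0 < d)%N.

Definition balance (p : d.-tuple R) : R := max_pbar p / min_pbar p.

Lemma min_pbar_gt0 : 0 < min_pbar p.
Proof.
rewrite /min_pbar; apply: (big_ind (fun x => 0 < x)) => [|x y x0 y0|i _].
- exact: (pbar_gt0 adm).
- by rewrite lt_min x0.
- exact: (pbar_gt0 adm).
Qed.

Lemma balance_ge1 : 1 <= balance p.
Proof.
rewrite ler_pdivlMr ?min_pbar_gt0// mul1r.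
apply: le_trans (bigmin_le _ ord_max _) _.
exact: (le_bigmax _ _ ord_max).
Qed.

(** As [p_1 + ... + p_{d+1} = 1], the largest [p_i] is at least
    [1 / (d + 1)]. *)
Lemma inv_pbar_le i : 1 / (n%:R * tnth (pbar p) i) <= 2 * d%:R * balance p / n%:R.
Proof.
have n0 : 0 < n%:R :> R by rewrite ltr0n; case: adm.
have m0 := min_pbar_gt0; have q0 := pbar_gt0 adm i.
have dR : 1 <= d%:R :> R by rewrite ler1n.
have M1 : 1 <= 2 * d%:R * max_pbar p.
  rewrite -[leLHS](pbar_sum1 adm); apply: le_trans (_ : \sum_(i < d.+1) max_pbar p <= _).
    by apply: ler_sum => j _; exact: le_bigmax.
  rewrite sumr_const card_ord -[_ *+ d.+1]mulr_natl; apply: ler_wpM2r.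
    by apply: le_trans (le_bigmax _ _ i); rewrite ltW.
  by rewrite -(natr1 d); lra.
have mq : min_pbar p <= tnth (pbar p) i by exact: bigmin_le.
have -> : 1 / (n%:R * tnth (pbar p) i) = 1 / tnth (pbar p) i / n%:R.
  by field; rewrite !gt_eqF.
apply: ler_wpM2r; first by rewrite invr_ge0 ltW.
apply: le_trans (_ : 1 / min_pbar p <= _); first by rewrite !div1r lef_pV2.
by rewrite /balance mulrA; apply: ler_wpM2r => //; rewrite invr_ge0 ltW.
Qed.

End balance.

Section normal_comparison.
Context {R : realType} (d N n : nat) (p : d.-tuple R).
Hypothesis adm : admissible N n p.
Hypothesis d_gt0 : (0 < d)%N.
Let n_gt0 : (0 < n)%N. Proof. by case: adm. Qed.
Let nR : 0 < n%:R :> R. Proof. by rewrite ltr0n. Qed.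
Local Notation leb := (lebesgue_tuple R d).
Local Notation comps := (compositions d n).

Let p_gt0 := admissible_gt0 adm.
Let q_gt0 := admissible_rest_gt0 adm.

Definition normal_density (x : d.-tuple R) : R :=
  mvnormal_pdf (n%:R *: row_of p) (n%:R *: multinomial_cov p) x.

(** The [d + 1] coordinates of a vector have sum [n], so moving the first [d]
    of them by [v] moves the last one as well. *)
Definition shift_vec (v : d.-tuple R) (i : 'I_d.+1) : R :=
  tnth [tuple of rcons v (- \sum_(j < d) tnth v j)] i.

Lemma shift_vec_widen v i : shift_vec v (widen_ord (leqnSn d) i) = tnth v i.
Proof. by rewrite /shift_vec (tnth_nth 0)/= nth_rcons size_tuple ltn_ord -tnth_nth. Qed.

Lemma shift_vec_max v : shift_vec v ord_max = - \sum_(j < d) tnth v j.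
Proof. by rewrite /shift_vec (tnth_nth 0)/= nth_rcons size_tuple ltnn eqxx. Qed.

Lemma normal_density_shift (v : d.-tuple R) (f : {ffun 'I_d.+1 -> 'I_n.+1}) : f \in comps ->
  normal_density (tuple_add v (point f)) =
  normal_weight (tnth (pbar p)) (shift_vec v) f.
Proof.
rewrite mem_compositions => /eqP sf.
rewrite /normal_density mvnormal_pdf_gauss_prod// /gauss_prod /normal_weight.
congr (_ / _); rewrite [in RHS]big_ord_recr/= (tnth_pbar_max adm) shift_vec_max.
congr (_ * _).
  apply: eq_bigr => i _; rewrite (tnth_pbar_widen p) shift_vec_widen !tnth_mktuple.
  by congr (gauss _ _); ring.
have gaussN v' x : gauss v' (- x) = gauss v' x :> R by rewrite /gauss sqrrN.
rewrite -[RHS]gaussN; congr (gauss _ _).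
have -> : \sum_(i < d) tnth (tuple_add v (point f)) i =
    \sum_(i < d) tnth v i + \sum_(i < d) (f (widen_ord (leqnSn d) i))%:R.
  by rewrite -big_split/=; apply: eq_bigr => i _; rewrite !tnth_mktuple.
have : (\sum_(i < d) (f (widen_ord (leqnSn d) i))%:R + (f ord_max)%:R = n%:R :> R).
  by rewrite -[in RHS]sf natr_sum [in RHS]big_ord_recr.
by rewrite -mulr_sumr mulrBr => <-; ring.
Qed.

Let mdensity : measurable_fun [set: d.-tuple R] normal_density.
Proof. exact: measurable_mvnormal_pdf. Qed.

Lemma normal_density_ge0 x : 0 <= normal_density x.
Proof.
by rewrite mulr_ge0 ?expR_ge0// invr_ge0 sqrtr_ge0.
Qed.

Lemma normal_density_gt0 x : 0 < normal_density x.
Proof.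
rewrite /normal_density mvnormal_pdf_gauss_prod// divr_gt0 ?gauss_gt0//.
rewrite mulr_gt0 ?gauss_gt0 ?mulr_gt0//.
by apply: prodr_gt0 => i _; rewrite gauss_gt0// mulr_gt0.
Qed.

Let integral_normal_density : (\int[leb]_x (normal_density x)%:E = 1)%E.
Proof. exact: integral_mvnormal_pdf. Qed.

(* The bound of [relative_entropy_le], where [v_i ^ 2 <= 1 / 4] has replaced
   [4 / m_i] by [33 / (8 m_i)]. The square of the sum is kept, since only its
   mean over the cube is small enough. *)
Let B (v : d.-tuple R) : R := \sum_(i < d.+1) 33 / 8 / (n%:R * tnth (pbar p) i) +
  (0 + \sum_(j < d) tnth v j) ^+ 2 / (2 * (n%:R * tnth (pbar p) ord_max)).

Let m_gt0 i : 0 < n%:R * tnth (pbar p) i.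
Proof. by rewrite mulr_gt0// (pbar_gt0 adm). Qed.

Lemma integral_entropy_bound :
  (\int[leb]_(v in @cube R d) (B v)%:E <=
   (17 * (d%:R ^+ 2 * balance p / n%:R))%:E)%E.
Proof.
have cube1 := @lebesgue_cube R d.
set S := \sum_(i < d.+1) 33 / 8 / (n%:R * tnth (pbar p) i).
have S0 : 0 <= S by apply: sumr_ge0 => i _; rewrite divr_ge0// ltW.
set c := (2 * (n%:R * tnth (pbar p) ord_max))^-1.
have c0 : 0 <= c by rewrite invr_ge0 mulr_ge0// ltW.
have msq : measurable_fun (@cube R d) (fun v : d.-tuple R => ((0 + \sum_(j < d) tnth v j) ^+ 2)%:E).
  apply/measurable_EFinP; apply: measurable_funTS; apply: measurable_funX.
  by apply: measurable_funD => //; exact: measurable_fun_sum_tnth.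
have -> : (\int[leb]_(v in @cube R d) (B v)%:E =
    \int[leb]_(v in @cube R d) ((cst S%:E) v + c%:E * ((0 + \sum_(j < d) tnth v j) ^+ 2)%:E))%E.
  by apply: eq_integral => v _; rewrite /B -/S -EFinM -EFinD [c * _]mulrC.
have mc := @measurable_cube R d.
rewrite ge0_integralD//; last 2 first.
- by move=> v _; rewrite mule_ge0// lee_fin sqr_ge0.
- exact: measurable_funeM.
rewrite ge0_integralZl//; last by move=> v _; rewrite lee_fin sqr_ge0.
have intS : (\int[leb]_(v in @cube R d) (cst S%:E) v = S%:E)%E.
  by rewrite integral_cst//; exact: etrans (congr1 (fun y => S%:E * y)%E cube1) (mule1 _).
rewrite intS integral_cube_sum_sqr expr0n/= add0r -EFinM -EFinD lee_fin.
set K := d%:R ^+ 2 * balance p / n%:R.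
have dR : 1 <= d%:R :> R by rewrite ler1n.
have r1 := balance_ge1 adm.
have r0 : 0 <= balance p by exact: le_trans r1.
have K0 : 0 <= K by rewrite divr_ge0// mulr_ge0// sqr_ge0.
set b := 2 * d%:R * balance p / n%:R.
have b0 : 0 <= b by rewrite divr_ge0// mulr_ge0// mulr_ge0.
have inv_le i : 1 / (n%:R * tnth (pbar p) i) <= b := inv_pbar_le adm d_gt0 i.
have db : d%:R * b = 2 * K by rewrite /b /K; ring.
have Sle : S <= 33 / 8 * (d.+1%:R * b).
  apply: le_trans (_ : \sum_(i < d.+1) 33 / 8 * b <= _).
    by apply: ler_sum => i _; have := inv_le i; rewrite div1r; lra.
  by rewrite sumr_const card_ord -[_ *+ d.+1]mulr_natl; lra.
have d1b : d.+1%:R * b <= 4 * K.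
  have : d.+1%:R * b <= 2 * d%:R * b by apply: ler_wpM2r => //; rewrite -(natr1 d); lra.
  by lra.
have cle : c * (d%:R / 12) <= K / 12.
  have cb : c <= b / 2.
    by have := inv_le ord_max; rewrite div1r /c (invfM 2); lra.
  have : c * d%:R <= b / 2 * d%:R by apply: ler_wpM2r.
  by lra.
by lra.
Qed.

Let entropy_shift_le (v : d.-tuple R) : cube v -> (forall i, 1 <= n%:R * tnth (pbar p) i) ->
  \sum_(f <- comps) multinomial_weight (tnth (pbar p)) f *
    (ln (multinomial_weight (tnth (pbar p)) f) -
     ln (normal_density (tuple_add v (point f)))) <= B v.
Proof.
move=> cv m1.
rewrite big_seq; under eq_bigr => f fn do rewrite normal_density_shift//.
rewrite -big_seq.
apply: le_trans (relative_entropy_le n_gt0 (pbar_gt0 adm) (pbar_sum1 adm) (shift_vec v) m1) _.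
rewrite /B big_split/= [X in _ + X <= _]big_ord_recr/= shift_vec_max sqrrN add0r addrA lerD2r.
rewrite -lerBrDl -sumrB.
have -> : \sum_(i < d.+1) (33 / 8 / (n%:R * tnth (pbar p) i) - 4 / (n%:R * tnth (pbar p) i)) =
    \sum_(i < d.+1) 1 / 8 / (n%:R * tnth (pbar p) i).
  by apply: eq_bigr => i _; rewrite -mulrBl; congr (_ / _); lra.
rewrite [leRHS]big_ord_recr/= -[leLHS]addr0 lerD//; last first.
  by rewrite divr_ge0// ltW.
apply: ler_sum => i _; rewrite shift_vec_widen invfM mulrA.
apply: ler_wpM2r; first by rewrite invr_ge0 ltW.
by have /andP[h1 h2] := cv i; nra.
Qed.

Lemma sum_excess_normal : (forall i, 1 <= n%:R * tnth (pbar p) i) ->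
  (\sum_(f <- comps) \int[leb]_(v in @cube R d)
     (excess (multinomial_weight (tnth (pbar p)) f)
        (normal_density (tuple_add v (point f))))%:E <=
   (Num.sqrt (2 * (17 * (d%:R ^+ 2 * balance p / n%:R))))%:E)%E.
Proof.
move=> m1.
have dR : 1 <= d%:R :> R by rewrite ler1n.
have r1 := balance_ge1 adm.
have q0 := pbar_gt0 adm.
apply: (@integral_excess_le_entropy _ _ _ _ _ (@measurable_cube R d) (@lebesgue_cube R d)
  _ comps _ (fun f v => normal_density (tuple_add v (point f))) B) => //.
- move=> f; rewrite /multinomial_weight mulr_gt0 ?divr_gt0 ?ltr0n ?fact_gt0//.
    by apply: prodr_gt0 => i _; rewrite ltr0n fact_gt0.
  by apply: prodr_gt0 => i _; rewrite exprn_gt0.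
- exact: (multinomial_sum1 _ (pbar_sum1 adm)).
- by move=> f v; exact: normal_density_gt0.
- move=> f; apply: measurable_funTS; apply: measurableT_comp => //.
  exact: measurable_tuple_add.
- exact: (sum_integral_cell_le1 _ mdensity normal_density_ge0 integral_normal_density).
- apply: measurable_funTS; apply: measurable_funD => //; apply: measurable_funM => //.
  apply: measurable_funX; apply: measurable_funD => //; exact: measurable_fun_sum_tnth.
- move=> v _; rewrite addr_ge0//.
    by apply: sumr_ge0 => i _; rewrite divr_ge0// ltW.
  by rewrite divr_ge0 ?sqr_ge0// mulr_ge0// ltW.
- by move=> v cv; exact: entropy_shift_le.
- have r0 : 0 < balance p by exact: lt_le_trans r1.
  have d0 : 0 < d%:R :> R by exact: lt_le_trans dR.
  by rewrite mulr_gt0// divr_gt0// mulr_gt0// exprn_gt0.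
- exact: integral_entropy_bound.
Qed.

End normal_comparison.

(** * The total variation bound *)

Section jittered_hypergeometric.
Context {R : realType} (d N n : nat) (p : d.-tuple R).
Hypothesis adm : admissible N n p.
Hypothesis d_gt0 : (0 < d)%N.
Context {disp : measure_display} {Omega : measurableType disp}.
Variables (P : probability Omega R) (K U X : {RV P >-> d.-tuple R}).
Hypothesis lawK : has_law P K (hypergeometric_law N n p).
Hypothesis lawU : has_law P U (@uniform_law R d).
Hypothesis indep : forall A B, measurable A -> measurable B ->
  (P (K @^-1` A `&` U @^-1` B) = P (K @^-1` A) * P (U @^-1` B))%E.
Hypothesis XE : forall o, X o = tuple_add (K o) (U o).
Local Open Scope ereal_scope.
Local Notation leb := (lebesgue_tuple R d).
Local Notation comps := (compositions d n).
Local Notation w f := (hypergeometric_pmf N n p (head_vec f)).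
Local Notation Q := (multinomial_weight (n := n) (tnth (pbar p))).
Local Notation phi := (normal_density n p).

Definition jittered_density (x : d.-tuple R) : R :=
  (\sum_(f <- comps) w f * \1_(cell (point f)) x)%R.

Let w_ge0 := @hypergeometric_pmf_ge0 R d N n p.

Lemma sum_hypergeometric : (\sum_(f <- comps) w f = 1)%R.
Proof.
exact: (sum_weights w_ge0 (@hypergeometric_sub _ _ _ _ _)
  (hypergeometric_pmf_supp adm) lawK).
Qed.

Let mcell (f : {ffun 'I_d.+1 -> 'I_n.+1}) : measurable_fun [set: d.-tuple R] (fun x => (w f * \1_(cell (point f)) x)%R).
Proof.
by apply: measurable_funM => //; apply: measurable_indic; exact: measurable_cell.
Qed.

Lemma measurable_jittered_density : measurable_fun [set: d.-tuple R] jittered_density.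
Proof. by apply: measurable_sum => f; exact: mcell. Qed.

Lemma jittered_density_ge0 x : (0 <= jittered_density x)%R.
Proof. by apply: sumr_ge0 => f _; rewrite mulr_ge0. Qed.

Lemma distribution_jittered A : measurable A ->
  distribution P X A = \int[leb]_(x in A) (jittered_density x)%:E.
Proof.
move=> mA; rewrite /distribution /pushforward.
rewrite (_ : X @^-1` A = [set o | A (tuple_add (K o) (U o))]); last first.
  by apply/seteqP; split => o /=; rewrite XE.
rewrite (prob_jittered w_ge0 (@hypergeometric_sub _ _ _ _ _)
  (hypergeometric_pmf_supp adm) lawK lawU indep mA).
under [RHS]eq_integral => x _ do rewrite /jittered_density -sumEFin.
rewrite ge0_integral_sum//; last 2 first.
- by move=> f; apply: measurable_funTS; apply/measurable_EFinP; exact: mcell.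
- by move=> f x _; rewrite lee_fin mulr_ge0.
apply: eq_bigr => f _; under [RHS]eq_integral do rewrite EFinM.
rewrite ge0_integralZl//.
- rewrite integral_indic//; first by rewrite setIC.
  exact: measurable_cell.
- apply/measurable_EFinP; apply: measurable_funTS.
  by apply: measurable_indic; exact: measurable_cell.
- by rewrite lee_fin w_ge0.
Qed.

Let integral_jittered_density : \int[leb]_x (jittered_density x)%:E = 1.
Proof.
by rewrite -distribution_jittered// /distribution /pushforward preimage_setT probability_setT.
Qed.

Let p_gt0 := admissible_gt0 adm.
Let q_gt0 := admissible_rest_gt0 adm.

Let n_gt0 : (0 < n%:R :> R)%R.
Proof. by rewrite ltr0n; case: adm. Qed.

Let mphi : measurable_fun [set: d.-tuple R] phi.
Proof. exact: measurable_mvnormal_pdf. Qed.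

Let integral_phi : \int[leb]_x (phi x)%:E = 1.
Proof. exact: integral_mvnormal_pdf. Qed.

Let normal := mvnormal_law (n%:R *: row_of p) (n%:R *: multinomial_cov p).

Lemma tv_norm_le_sum_excess : tv_norm (distribution P X) normal <=
  2%:E * \sum_(f <- comps) \int[leb]_(v in @cube R d)
     (excess (w f) (phi (tuple_add v (point f))))%:E.
Proof.
apply: le_trans (tv_norm_le_excess measurable_jittered_density mphi
  jittered_density_ge0 (@normal_density_ge0 _ _ _ _) distribution_jittered _
  integral_jittered_density integral_phi) _; first by [].
rewrite lee_pmul2l//.
exact: (integral_excess_cells_le mphi (@normal_density_ge0 _ _ _ _)).
Qed.

Let integral_cube_cst c : (0 <= c)%R -> \int[leb]_(v in @cube R d) (cst c%:E) v = c%:E.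
Proof.
move=> c0; rewrite integral_cst//; last exact: measurable_cube.
exact: etrans (congr1 (fun y => c%:E * y) (lebesgue_cube d)) (mule1 _).
Qed.

Let mexc f g : measurable_fun (@cube R d)
  (fun v => (excess f (phi (tuple_add v (@point R d n g))))%:E).
Proof.
apply: measurable_funTS; apply/measurable_EFinP.
apply: (@measurable_excess _ _ _ (fun=> f)) => //.
by apply: measurableT_comp => //; exact: measurable_tuple_add.
Qed.

Lemma tv_norm_le2 : tv_norm (distribution P X) normal <= 2%:E.
Proof.
apply: le_trans tv_norm_le_sum_excess _.
rewrite -[leRHS]mule1 lee_pmul2l// -sum_hypergeometric -sumEFin.
apply: lee_sum => f _; rewrite -[leRHS]integral_cube_cst//.
apply: ge0_le_integral => //; first exact: measurable_cube.
- by move=> v _; rewrite lee_fin excess_ge0.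
- move=> v _; rewrite lee_fin /excess ge_max w_ge0 andbT.
  by rewrite lerBlDr lerDl normal_density_ge0.
Qed.

Lemma excess_triangle (a b c : R) : (excess a c <= excess a b + excess b c)%R.
Proof.
have le_excess (x y : R) : (x - y <= excess x y)%R by rewrite le_max lexx.
have := le_excess a b; have := le_excess b c.
have := excess_ge0 a b; have := excess_ge0 b c.
by rewrite [excess a c]/excess ge_max => h1 h2 h3 h4; apply/andP; split; lra.
Qed.

Lemma tv_norm_le_large_mean : (forall i, 1 <= n%:R * tnth (pbar p) i)%R ->
  tv_norm (distribution P X) normal <=
  (Num.sqrt (2 * (n%:R ^+ 2 / N%:R)) +
   2 * Num.sqrt (2 * (17 * (d%:R ^+ 2 * balance p / n%:R))))%:E.
Proof.
move=> m1; apply: le_trans tv_norm_le_sum_excess _.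
have mc := @measurable_cube R d.
apply: le_trans (_ : 2%:E * (\sum_(f <- comps) (excess (w f) (Q f))%:E +
   \sum_(f <- comps) \int[leb]_(v in @cube R d)
     (excess (Q f) (phi (tuple_add v (point f))))%:E) <= _).
  rewrite lee_pmul2l// -big_split/=; apply: lee_sum => f _.
  rewrite -[X in _ <= X + _]integral_cube_cst ?excess_ge0//.
  rewrite -ge0_integralD//; last 2 first.
  - by move=> v _; rewrite lee_fin excess_ge0.
  - by move=> v _; rewrite lee_fin excess_ge0.
  apply: ge0_le_integral => //.
  - by move=> v _; rewrite lee_fin excess_ge0.
  - by apply: emeasurable_funD => //; exact: mexc.
  - by move=> v _; rewrite -EFinD lee_fin excess_triangle.
rewrite ge0_muleDr; last 2 first.
- by rewrite sumEFin lee_fin sumr_ge0// => f _; rewrite excess_ge0.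
- by apply: sume_ge0 => f _; apply: integral_ge0 => v _; rewrite lee_fin excess_ge0.
rewrite [leRHS]EFinD [X in _ <= _ + X]EFinM leeD//.
  by rewrite sumEFin -EFinM lee_fin; apply: sum_excess_hypergeometric => //; exact: sum_hypergeometric.
by rewrite lee_pmul2l//; exact: (sum_excess_normal adm d_gt0 m1).
Qed.

Lemma tv_norm_jittered_le : tv_norm (distribution P X) normal <=
  (Num.sqrt (2 * (n%:R ^+ 2 / N%:R)) +
   12 * (d%:R / Num.sqrt n%:R * Num.sqrt (balance p)))%:E.
Proof.
have dR : (1 <= d%:R :> R)%R by rewrite ler1n.
have r1 := balance_ge1 adm.
have r0 : (0 <= balance p)%R by exact: le_trans r1.
set y := (d%:R / Num.sqrt n%:R * Num.sqrt (balance p))%R.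
have y0 : (0 <= y)%R by rewrite mulr_ge0// divr_ge0.
have yy : (y ^+ 2 = d%:R ^+ 2 * balance p / n%:R)%R.
  by rewrite !exprMn exprVn !sqr_sqrtr// ?(ltW n_gt0)// mulrAC.
clearbody y.
(* [2 sqrt (34 y ^ 2) <= 12 y] gives the constant. *)
have [m1|] := pselect (forall i, 1 <= n%:R * tnth (pbar p) i)%R.
  apply: le_trans (tv_norm_le_large_mean m1) _.
  rewrite lee_fin lerD2l -yy.
  have : (Num.sqrt (2 * (17 * y ^+ 2)) <= Num.sqrt ((6 * y) ^+ 2))%R.
    apply: ler_wsqrtr; have := sqr_ge0 y; rewrite exprMn.
    have -> : (6 ^+ 2 = 36 :> R)%R by ring.
    by lra.
  by rewrite sqrtr_sqr ger0_norm ?mulr_ge0//; lra.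
(* If [m_i < 1] for some [i], then the right-hand side exceeds [2]. *)
move=> /existsNP[i /negP]; rewrite -ltNge => m1.
apply: le_trans tv_norm_le2 _; rewrite lee_fin.
apply: ler_wpDl; first exact: sqrtr_ge0.
have m0 : (0 < n%:R * tnth (pbar p) i)%R by rewrite mulr_gt0// (pbar_gt0 adm).
have : (1 < 2 * y ^+ 2)%R.
  apply: (@lt_le_trans _ _ (1 / (n%:R * tnth (pbar p) i))%R).
    by rewrite ltr_pdivlMr// mul1r.
  apply: le_trans (inv_pbar_le adm d_gt0 i) _; rewrite yy.
  have -> : (2 * (d%:R ^+ 2 * balance p / n%:R) =
      d%:R * (2 * d%:R * balance p / n%:R))%R by ring.
  by rewrite ler_peMl// divr_ge0// mulr_ge0.
by move=> y2; nra.
Qed.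

End jittered_hypergeometric.

Lemma bigO_scale (R : realType) (d : nat) (c C : R) (v : nat -> nat -> d.-tuple R -> R) :
  0 <= c -> c < C -> bigO_N C (fun N n p => c * v N n p) v.
Proof.
move=> c0 cC; rewrite /bigO_N; apply: (@le_lt_trans _ _ c%:E); last by rewrite lte_fin.
rewrite limn_esup_lim; apply: lime_le; first exact: is_cvg_esups.
apply: nearW => k; apply: ge_ereal_sup => _ [N _ <-].
apply: ge_ereal_sup => _ [[n p] _ <-]; rewrite lee_fin /=.
have [->|v0] := eqVneq (v N n p) 0; first by rewrite mulr0 mul0r normr0.
by rewrite mulfK// ger0_norm.
Qed.

Unset Implicit Arguments.

Theorem theorem2 (R : realType) :
  exists2 C : R, 0 < C &
  forall d : nat, (0 < d)%N ->
  exists E1 E2 : nat -> nat -> d.-tuple R -> R,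
  [/\ bigO_N C E1 (fun N n p => n%:R ^+ 2 / N%:R),
      bigO_N C E2 (fun N n p =>
        d%:R / Num.sqrt n%:R * Num.sqrt (max_pbar p / min_pbar p)) &
      forall (N n : nat) (p : d.-tuple R), admissible N n p ->
      forall (disp : measure_display) (Omega : measurableType disp)
        (P : probability Omega R) (K L U V X Y : {RV P >-> d.-tuple R}),
      has_law P K (hypergeometric_law N n p) ->
      has_law P L (multinomial_law n p) ->
      has_law P U (@uniform_law R d) ->
      has_law P V (@uniform_law R d) ->
      mutually_independent P [tuple K; L; U; V] ->
      (forall w, X w = tuple_add (K w) (U w)) ->
      (forall w, Y w = tuple_add (L w) (V w)) ->
      (tv_norm (distribution P X)
         (mvnormal_law (n%:R *: row_of p) (n%:R *: multinomial_cov p))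
       <= (Num.sqrt (2 * deviation_sum n p + E1 N n p) + E2 N n p)%:E)%E].
Proof.
exists 13 => // d d0.
exists (fun N n p => 2 * (n%:R ^+ 2 / N%:R)).
exists (fun N n p => 12 * (d%:R / Num.sqrt n%:R * Num.sqrt (max_pbar p / min_pbar p))).
split; [by apply: bigO_scale => //; lra|by apply: bigO_scale => //; lra|].
move=> N n p adm disp Omega P K L U V X Y lawK lawL lawU lawV ind XE YE.
have indep A B : measurable A -> measurable B ->
    P (K @^-1` A `&` U @^-1` B) = (P (K @^-1` A) * P (U @^-1` B))%E.
  move=> mA mB.
  (* [K] and [U] are the components [0] and [2] of the quadruple. *)
  pose F (i : 'I_4) : set (d.-tuple R) :=
    if i == 0%N :> nat then A else if i == 2%N :> nat then B else setT.
  have mF i : measurable (F i) by rewrite /F; do 2 case: ifP => // _.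
  have := ind F mF; rewrite !big_ord_recl big_ord0 /F/= !(tnth_nth K)/=.
  rewrite !preimage_setT !probability_setT !mule1 mul1e => <-.
  congr (P _); apply/seteqP; split => w /=.
    move=> [Aw Bw] [[|[|[|[|//]]]] i4]; rewrite !(tnth_nth K)//=.
  move=> h; split; first by have := h (@Ordinal 4 0 isT).
  by have := h (@Ordinal 4 2 isT); rewrite !(tnth_nth K).
apply: le_trans (tv_norm_jittered_le adm d0 lawK lawU indep XE) _.
rewrite lee_fin lerD2r ler_wsqrtr// lerDr mulr_ge0//.
by apply: sumr_ge0 => i _; rewrite mulr_ge0 ?powR_ge0.
Qed.
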